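(* Let $(\xi,\eta)$ be a random vector in $\mathbb{R}^2$ with $\mathbb{P}\{\xi>0\}>0$. Suppose that $\mathbb{E}\xi=-a<0$ (with $a$ finite), $\eta>0$ and $\mathbb{E}\log(1+\eta)<\infty$. Let $D_\infty$ and $\widetilde D_\infty$ be the perpetuities driven by $(\xi,\eta)$, let $H$ be the distribution of $\xi+\log(1+\eta)$ and let $\widetilde H$ be the distribution of $\max(\xi,\log(1+\eta))$, with integrated tail distributions $H_I$ and $\widetilde H_I$. (1) If $H_I$ is long-tailed, then $$\liminf_{x\to\infty}\frac{\mathbb{P}\{D_\infty>x\}}{\overline{H_I}(\log x)}\ \ge\ \frac1a .$$ If, in addition, $H_I$ is subexponential, then $$\mathbb{P}\{D_\infty>x\}\ \sim\ \frac1a\,\overline{H_I}(\log x)\quad\text{as }x\to\infty .$$ (2) The same results hold for $\widetilde D_\infty$ with $\widetilde H_I$ in place of $H_I$: if $\widetilde H_I$ is long-tailed, then $$\liminf_{x\to\infty}\frac{\mathbb{P}\{\widetilde D_\infty>x\}}{\overline{\widetilde H_I}(\log x)}\ \ge\ \frac1a ,$$ and if, in addition, $\widetilde H_I$ is subexponential, then $$\mathbb{P}\{\widetilde D_\infty>x\}\ \sim\ \frac1a\,\overline{\widetilde H_I}(\log x)\quad\text{as }x\to\infty .$$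
   Context: Let $(\xi_k,\eta_k)$, $k\ge1$, be independent copies of $(\xi,\eta)$ (the components $\xi$ and $\eta$ may be dependent), $S_0:=0$, $S_n:=\xi_1+\dots+\xi_n$. Define $$D_\infty:=\sum_{k=1}^\infty \eta_k e^{S_k},\qquad \widetilde D_\infty:=\sum_{k=1}^\infty \eta_k e^{S_{k-1}},$$ which are finite almost surely under the stated assumptions. For a distribution $H$ on $\mathbb{R}$, $\overline H(x)=H(x,\infty)$ denotes its tail. For $H$ with finite expectation, the integrated tail distribution $H_I$ is the distribution on $\mathbb{R}^+$ with tail $\overline{H_I}(x):=\min\bigl(1,\int_x^\infty\overline H(y)\,dy\bigr)$. A distribution $H$ with right unbounded support is long-tailed if, for each fixed $y$, $\overline H(x+y)\sim\overline H(x)$ as $x\to\infty$. A distribution $H$ on $\mathbb{R}^+$ with unbounded support is subexponential if $\overline{H*H}(x)\sim2\overline H(x)$ as $x\to\infty$. The notation $u(x)\sim v(x)$ means $u(x)/v(x)\to1$. *)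

(* Defs.v *)
From HB Require Import structures.
From mathcomp Require Import all_boot all_order all_algebra finmap.
From mathcomp Require Import all_classical all_reals all_analysis.
From mathcomp Require Import measurable_realfun lra.

Set Implicit Arguments.
Unset Strict Implicit.
Unset Printing Implicit Defensive.

Import Order.TTheory GRing.Theory Num.Theory.
Import numFieldNormedType.Exports.

Local Open Scope classical_set_scope.
Local Open Scope ring_scope.

Definition log1p d (T : measurableType d) (R : realType) (Y : T -> R) (w : T) : R :=
  ln (1 + Y w).

Lemma measurable_log1p d (T : measurableType d) (R : realType)
  (Y : {mfun T >-> R}) : measurable_fun setT (log1p Y).
Proof.
apply: measurableT_comp; first exact: measurable_ln.
exact: (measurable_funPT (cst 1 \+ Y : {mfun T >-> R})).
Qed.

HB.instance Definition _ d (T : measurableType d) (R : realType)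
    (Y : {mfun T >-> R}) :=
  isMeasurableFun.Build _ _ _ _ (log1p Y) (measurable_log1p Y).

Definition same_law d0 d d' (T0 : measurableType d0) (T : measurableType d)
    (U : measurableType d') (R : realType)
    (P0 : probability T0 R) (X : T0 -> U) (P : probability T R) (Y : T -> U) :=
  forall A : set U, measurable A -> P (Y @^-1` A) = P0 (X @^-1` A).

Definition mutually_independent d d' (T : measurableType d)
    (U : measurableType d') (R : realType) (P : probability T R)
    (X : nat -> T -> U) :=
  forall (I : {fset nat}) (A : nat -> set U), (forall k, measurable (A k)) ->
    P (\bigcap_(k in [set` I]) (X k @^-1` A k)) =
    (\prod_(k <- I) P (X k @^-1` A k))%E.

Definition independent_copies d0 d d' (T0 : measurableType d0)
    (T : measurableType d) (U : measurableType d') (R : realType)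
    (P0 : probability T0 R) (X0 : T0 -> U) (P : probability T R)
    (X : nat -> T -> U) :=
  (forall k, same_law P0 X0 P (X k)) /\ mutually_independent P X.

(* Sequences are indexed from 0: [xi k] and [eta k] stand for the
   $(k+1)$-st copies $\xi_{k+1}$ and $\eta_{k+1}$. *)
Definition walk (T : Type) (R : realType) (xi : nat -> T -> R) (n : nat)
  (w : T) : R := \sum_(k < n) xi k w.

(* Valued in [\bar R], so that no convergence has to be assumed. *)
Definition perpetuity (T : Type) (R : realType) (xi eta : nat -> T -> R)
    (w : T) : \bar R :=
  (\sum_(0 <= k <oo) (eta k w * expR (walk xi k.+1 w))%:E)%E.

Definition perpetuity_tilde (T : Type) (R : realType) (xi eta : nat -> T -> R)
    (w : T) : \bar R :=
  (\sum_(0 <= k <oo) (eta k w * expR (walk xi k w))%:E)%E.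

Definition tail (R : realType) (H : set R -> \bar R) (x : R) : \bar R :=
  H `]x, +oo[%classic.

(* $\overline{G}(x) = \min(1, \int_x^\infty \overline{H}(y)\,dy)$ is required
   only for $x \ge 0$: on the negative half-line this formula may differ from 1,
   whereas $G$ is carried by $[0, \infty)$ (it has an atom at 0 when the
   integral at 0 is less than 1). *)
Definition is_integrated_tail (R : realType) (H G : probability R R) :=
  G `]-oo, 0[%classic = 0%E /\
  forall x : R, 0 <= x ->
    tail G x = mine 1%E (\int[lebesgue_measure]_(y in `[x, +oo[) tail H y)%E.

(* Existence of $H_I$ when $H$ has finite expectation is
   [integrated_tailP]; the default value is irrelevant. *)
Definition integrated_tail (R : realType) (H : probability R R) :
    probability R R :=
  xget (\d_(0 : R) : probability R R) [set G | is_integrated_tail H G].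

Definition asymp_equiv (R : realType) (u v : R -> R) :=
  u x / v x @[x --> +oo] --> (1 : R).

Definition long_tailed (R : realType) (H : probability R R) :=
  (forall x : R, 0 < tail H x)%E /\
  forall y : R,
    asymp_equiv (fun x => fine (tail H (x + y))) (fun x => fine (tail H x)).

Definition convolution (R : realType) (G H : probability R R) :
    set R -> \bar R :=
  pushforward (G \x H)%E (fun z : R * R => z.1 + z.2).

Definition subexponential (R : realType) (H : probability R R) :=
  [/\ H `]-oo, 0[%classic = 0%E,
      (forall x : R, 0 < tail H x)%E &
      asymp_equiv (fun x => fine (tail (convolution H H) x))
                  (fun x => 2 * fine (tail H x))].

Definition upper_prob d (T : measurableType d) (R : realType)
    (P : probability T R) (D : T -> \bar R) (x : R) : R :=
  fine (P [set w | (x%:E < D w)%E]).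

Section integrated_tail_existence.
Context (R : realType) (H : probability R R).
Local Notation mu := (@lebesgue_measure R).
Local Notation I x := (\int[mu]_(y in `[x, +oo[) tail H y)%E.

Let idR : R -> R := idfun.
#[local] HB.instance Definition _ :=
  @isMeasurableFun.Build _ _ _ _ idR (@measurable_id _ _ setT).

Lemma tail_ge0 x : (0 <= tail H x)%E. Proof. exact: measure_ge0. Qed.
Lemma tail_le1 x : (tail H x <= 1)%E. Proof. exact: probability_le1. Qed.
Lemma measurable_tail (D : set R) : measurable_fun D (tail H).
Proof.
apply: measurable_funTS; exact: (@ccdf_measurable _ _ _ H (idR : {RV H >-> R})).
Qed.

Let I_split x y : x <= y ->
  I x = (\int[mu]_(z in `[x, y[) tail H z + I y)%E.
Proof.
move=> xy.
have -> : `[x, +oo[%classic = `[x, y[ `|` `[y, +oo[ :> set R.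
  by rewrite -(@itv_bndbnd_setU _ _ (BLeft x) (BLeft y) +oo%O).
apply: ge0_integral_setU => //.
- exact: measurable_tail.
- apply/disj_setPS => z [] /=; rewrite !in_itv/= andbT => /andP[_ zy].
  by rewrite leNgt zy.
Qed.

Let I_ge0 x : (0 <= I x)%E.
Proof. by apply: integral_ge0 => z _; exact: tail_ge0. Qed.

Let I_lip x y : x <= y -> (I x <= (y - x)%:E + I y)%E.
Proof.
move=> xy; rewrite (I_split xy) leeD2r//.
apply: (@le_trans _ _ (\int[mu]_(z in `[x, y[) (cst 1 z))%E).
  apply: ge0_le_integral => //=; first exact: measurable_tail.
  by move=> z _; exact: tail_le1.
rewrite integral_cst// mul1e [X in (X <= _)%E]lebesgue_measure_itv/=.
by case: ifP => // _; rewrite ?lee_fin ?subr_ge0// EFinB.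
Qed.

Let I_noninc x y : x <= y -> (I y <= I x)%E.
Proof.
move=> xy; rewrite (I_split xy) leeDr//.
by apply: integral_ge0 => z _; exact: tail_ge0.
Qed.

Hypothesis I0 : (I 0%R < +oo)%E.

Let I_fin x : 0 <= x -> I x \is a fin_num.
Proof.
move=> x0; rewrite ge0_fin_numE//; apply: le_lt_trans I0; exact: I_noninc.
Qed.

Let g x := fine (I x).

Let gK x : 0 <= x -> (g x)%:E = I x.
Proof. by move=> x0; rewrite /g fineK// I_fin. Qed.

Let g_noninc x y : 0 <= x -> x <= y -> g y <= g x.
Proof.
move=> x0 xy; rewrite -lee_fin !gK//; first exact: I_noninc.
exact: le_trans xy.
Qed.

Let g_lip x y : 0 <= x -> x <= y -> g x <= (y - x) + g y.
Proof.
move=> x0 xy; rewrite -lee_fin EFinD !gK//; first exact: I_lip.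
exact: le_trans xy.
Qed.

Let g_ge0 x : 0 <= g x. Proof. exact: fine_ge0. Qed.

Let g_cvg0 : g x @[x --> +oo] --> (0 : R).
Proof.
have h1 : (\int[mu]_(z in `[0%R, n%:R[) tail H z @[n --> \oo] --> I 0%R)%E.
  have -> : `[(0:R), +oo[%classic = \bigcup_n `[(0:R), n%:R[%classic.
    by rewrite -itvbndyEbigcup.
  pose J n : set R := `[(0:R), n%:R[%classic.
  rewrite -[X in (\int[mu]_(y in X) _)%E]/(\bigcup_n J n).
  apply: (@ge0_nondecreasing_set_cvg_integral _ (measurableTypeR R) R J (tail H) mu) => //.
  - by move=> m n mn; apply/subsetPset/subset_itvl; rewrite bnd_simp ler_nat.
  - by move=> n; exact: measurable_itv.
  - by move=> n mJ Y mY; exact: (@measurable_tail (J n) mJ Y mY).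
have h2 : (fun n : nat => g 0 - fine (\int[mu]_(z in `[0%R, n%:R[) tail H z)%E) @ \oo --> g 0 - g 0.
  apply: cvgB; first exact: cvg_cst.
  by apply: fine_cvg; rewrite gK.
have h3 n : g 0 - fine (\int[mu]_(z in `[0%R, n%:R[) tail H z)%E = g n%:R.
  apply/eqP; rewrite subr_eq -eqe EFinD !gK//.
  have J : (0 <= \int[mu]_(z in `[0%R, n%:R[) tail H z)%E.
    by apply: integral_ge0 => z _; exact: tail_ge0.
  rewrite fineK; last first.
    rewrite ge0_fin_numE//; apply: le_lt_trans I0.
    by rewrite (@I_split 0 n%:R)// leeDl.
  by rewrite addeC -I_split.
move: h2; rewrite subrr (eq_cvg _ _ h3) => /cvgrPdist_lt h2.
apply/cvgrPdist_lt => e e0; have [N _ hN] := h2 e e0.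
near=> x; rewrite sub0r normrN ger0_norm//.
apply: le_lt_trans (hN N (leqnn N)); rewrite sub0r normrN ger0_norm//.
by apply: g_noninc => //; near: x; apply: nbhs_pinfty_ge; rewrite num_real.
Unshelve. all: by end_near. Qed.

Let F x := if x < 0 then 0 else 1 - Num.min 1 (g x).

Let F_nd : nondecreasing F.
Proof.
move=> x y xy; rewrite /F; case: ltP => x0; case: ltP => y0 //.
- by rewrite subr_ge0 ge_min lexx.
- by move: (lt_le_trans y0 (le_trans x0 xy)); rewrite ltxx.
- rewrite lerD2l lerN2 le_min ge_min lexx/= ge_min; apply/orP; right.
  exact: g_noninc.
Qed.

Let F_lip x y : 0 <= x -> x <= y -> F y <= F x + (y - x).
Proof.
move=> x0 xy; have y0 := le_trans x0 xy.
rewrite /F (ltNge x) x0 (ltNge y) y0/= -addrA lerD2l lerNl opprD opprK.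
have := g_lip x0 xy; rewrite -subr_ge0 in xy.
case: (leP 1 (g x)) => h1; case: (leP 1 (g y)) => h2 h3; lra.
Qed.

Let F_rc : right_continuous F.
Proof.
move=> x; apply/cvgrPdist_lt => e e0.
have [x0|x0] := ltP x 0.
  near=> y; suff -> : F y = F x by rewrite subrr normr0.
  by rewrite /F x0 (_ : y < 0)//; near: y; apply: nbhs_right_lt.
near=> y.
have xy : x <= y by near: y; exact: nbhs_right_ge.
have := F_lip x0 xy; have := F_nd xy => h1 h2.
rewrite ler0_norm ?subr_le0// opprB ltrBlDr addrC.
apply: le_lt_trans h2 _; rewrite ltrD2l ltrBlDl.
by near: y; apply: nbhs_right_lt; rewrite ltrDl.
Unshelve. all: by end_near. Qed.

#[local] HB.instance Definition _ := isCumulative.Build R _ R F F_nd F_rc.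

Let F_Ny : F @ -oo --> (0 : R).
Proof.
apply/cvgrPdist_lt => e e0; near=> y.
suff -> : F y = 0 by rewrite subrr normr0.
have y0 : y < 0 by near: y; apply: nbhs_ninfty_lt; rewrite num_real.
by rewrite /F y0.
Unshelve. all: by end_near. Qed.

Let F_y : F @ +oo --> (1 : R).
Proof.
move/cvgrPdist_lt: g_cvg0 => h.
apply/cvgrPdist_lt => e e0; near=> y.
have y0 : 0 <= y by near: y; apply: nbhs_pinfty_ge; rewrite num_real.
rewrite /F (ltNge y) y0/= opprB addrC subrK ger0_norm ?le_min ?ler01 ?g_ge0//.
have : `|0 - g y| < e by near: y; exact: h.
rewrite sub0r normrN ger0_norm// => hg.
by rewrite gt_min hg orbT.
Unshelve. all: by end_near. Qed.

#[local] HB.instance Definition _ := isCumulativeBounded.Build R 0 1 F F_Ny F_y.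

Let idTR : measurableTypeR R -> R := idfun.
#[local] HB.instance Definition _ :=
  @isMeasurableFun.Build _ _ _ _ idTR (@measurable_id _ _ setT).

Let lsF := lebesgue_stieltjes_measure F.
Let G : probability R R := distribution lsF (idTR : {RV lsF >-> R}).

Let tailG x : tail G x = (1 - (F x)%:E)%E.
Proof. by rewrite -cdf_lebesgue_stieltjes_id -ccdf_1_cdf. Qed.

Lemma integrated_tail_exists : exists G, is_integrated_tail H G.
Proof.
exists G; split.
  have c x : G `]-oo, x]%classic = (F x)%:E.
    exact: (cdf_lebesgue_stieltjes_id F x).
  have -> : `]-oo, (0:R)[%classic = \bigcup_n `]-oo, (- n.+1%:R^-1 : R)]%classic.
    apply/seteqP; split=> [z /= | z [n _] /=]; rewrite !in_itv/=; last first.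
      by move=> /le_lt_trans; apply; rewrite oppr_lt0 invr_gt0.
    move=> z0; have nz0 : 0 < - z by rewrite oppr_gt0.
    have [n _ /(_ n (leqnn n)) hn] := near_infty_natSinv_lt (PosNum nz0).
    by exists n => //=; rewrite in_itv/= lerNr ltW.
  apply: measure_negligible; first exact: bigcup_measurable.
  apply: negligible_bigcup => k; apply/negligibleP => //.
  by apply: (etrans (c _)); rewrite /F oppr_lt0 invr_gt0 ltr0n.
move=> x x0; rewrite tailG /F (ltNge x) x0/=.
rewrite -gK// -EFin_min -EFinB opprB addrC subrK//.
Qed.

End integrated_tail_existence.

Section integrated_tail_correct.
Context (R : realType) (H : probability R R).

Let idR : R -> R := idfun.
#[local] HB.instance Definition _ :=
  @isMeasurableFun.Build _ _ _ _ idR (@measurable_id _ _ setT).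

Lemma integrable_tail : H.-integrable setT (EFin : R -> \bar R) ->
  (\int[lebesgue_measure]_(y in `[0%R, +oo[) tail H y < +oo)%E.
Proof.
move=> iH; pose X : {RV H >-> R} := (idR \max cst 0 : {mfun R >-> R}).
have X0 x : 0 <= X x by rewrite /X/= le_max lexx orbT.
have <- : ('E_H[X] = \int[lebesgue_measure]_(y in `[0%R, +oo[) tail H y)%E.
  rewrite ge0_expectation_ccdf//; apply: eq_integral => r.
  rewrite inE/= in_itv/= andbT => r0; congr (H _).
  apply/seteqP; split => z /=; rewrite !in_itv/= !andbT lt_max; last by move=> ->.
  by move=> /orP[//|/=]; rewrite ltNge r0.
rewrite expectation_def; move/integrableP : iH => [_]; apply: le_lt_trans.
apply: ge0_le_integral => //=.
- by move=> x _; rewrite lee_fin; exact: X0.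
- apply/measurable_EFinP; exact: (measurable_funPT X).
- apply/measurable_EFinP; exact: normr_measurable.
- by move=> x _; rewrite lee_fin ge_max ler_norm normr_ge0.
Qed.

Lemma integrated_tailP : H.-integrable setT (EFin : R -> \bar R) ->
  is_integrated_tail H (integrated_tail H).
Proof.
move=> /integrable_tail /integrated_tail_exists.
exact: (@xgetPex _ _ [set G | is_integrated_tail H G]).
Qed.

End integrated_tail_correct.

(* Main.v *)
(* Put zeta = xi + log (1 + eta) for D and zeta = max (xi, log (1 + eta)) for the
   other perpetuity. Up to a bounded factor log D is sup_k (S_k + zeta_(k+1)): a
   small extra drift makes the series geometric, which gives the upper bound, and
   for the lower bound the term that follows the big one makes up for
   eta < 1 + eta. So the theorem reduces to the supremum of a perturbed random
   walk, that is, to P (S_k + zeta_(k+1) > x for some k) ~ H_I(x) / a.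

   Upper bound: let the walk first jump above a high level A. The expected time
   it spends in (-t, A] is at most t / a up to o(t) (a supersolution argument),
   so integrating the tail of zeta against this potential bounds the tail of
   that jump by H_I / a. What remains after the jump is a copy of the whole
   supremum, and it is reached again with small probability, so subexponentiality
   of H_I closes the recursion. That the supremum is finite follows from the
   maximal ergodic inequality, without any law of large numbers.

   Lower bound: by the same finiteness result, applied to the steps
   - (xi + a + epsilon), S_k >= - (a + epsilon) k - C for each k with probability
   close to 1; the events that zeta_(k+1) is the first to exceed
   x + (a + epsilon) k + C are disjoint, and summing their probabilities gives
   H_I / a. *)

Require Import Defs.
From HB Require Import structures.
From mathcomp Require Import all_boot all_order all_algebra finmap.
From mathcomp Require Import all_classical all_reals all_analysis.
From mathcomp Require Import measurable_realfun lra ring.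

Set Implicit Arguments.
Unset Strict Implicit.
Unset Printing Implicit Defensive.

Import Order.TTheory GRing.Theory Num.Theory.
Import numFieldNormedType.Exports.

Local Open Scope classical_set_scope.
Local Open Scope ring_scope.

(** Of [xi] only a finite mean is assumed, so its lower tail is arbitrary. A step that jumps far
    below an interval would spoil a linear supersolution; steps are therefore truncated at [- L],
    which hardly changes the drift. A possible return from far below has probability at most [q].
    The price is a factor [1 / (1 - q)] and an additive [K + L], and no renewal theorem is involved.
    The upper estimates condition on the first step and are inductions on the horizon [n], uniform
    in [n]. The recursion for the supremum is closed in two passes: it first yields a crude bound
    [k * Fb], and then the sharp constant, since in one step the coefficient of [k] can be made as
    small as desired. As [eta > 0] holds only almost surely, the inequality between step and
    perturbation is forced everywhere by a maximum, and the series must be shown measurable without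
    any sign condition. *)

Ltac meas1 :=
  match goal with
  | |- measurable _ => first [exact: measurableT | assumption]
  | H : measurable_fun setT ?f |- measurable_fun _ ?f => exact: H
  | |- measurable_fun _ (fun x => x) => exact: measurable_id
  | |- measurable_fun _ fst => exact: measurable_fst
  | |- measurable_fun _ snd => exact: measurable_snd
  | |- measurable_fun _ (fun _ => ?c) => exact: measurable_cst
  | |- measurable_fun _ (fun x => if _ then _ else _) =>
      apply: measurable_fun_ifT
  | |- measurable_fun _ (fun x => (_ < _)%R) => apply: measurable_fun_ltr
  | |- measurable_fun _ (fun x => (_ <= _)%R) => apply: measurable_fun_ler
  | |- measurable_fun _ (Order.lt ?a) =>
      apply: (@measurable_fun_ltr _ _ _ _ (fun=> a) (fun x => x))
  | |- measurable_fun _ (Order.le ?a) =>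
      apply: (@measurable_fun_ler _ _ _ _ (fun=> a) (fun x => x))
  | |- measurable_fun _ (fun x => _ && _) => apply: measurable_and
  | |- measurable_fun _ (fun x => Num.max _ _) => apply: measurable_maxr
  | |- measurable_fun _ (fun x => Num.min _ _) => apply: measurable_minr
  | |- measurable_fun _ (fun x => _%:E) => apply/measurable_EFinP
  | |- measurable_fun _ (fun x => (_ + _)%E) => apply: emeasurable_funD
  | |- measurable_fun _ (fun x => @GRing.add _ _ _) =>
      apply: emeasurable_funD
  | |- measurable_fun _ (fun x => (_ * _)%E) => apply: emeasurable_funM
  | |- measurable_fun _ (fun x => (- _)%R) => apply: measurable_funN
  | |- measurable_fun _ (fun x => (_ + _)%R) => apply: measurable_funD
  | |- measurable_fun _ (fun x => (_ * _)%R) => apply: measurable_funM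
  | |- measurable_fun _ (fun x => (_, _)) =>
      apply: measurable_fun_pair
  | |- measurable_fun _ (fun x => x.1) => exact: measurable_fst
  | |- measurable_fun _ (fun x => x.2) => exact: measurable_snd
  | H : measurable_fun setT ?f |- measurable_fun _ (fun x => ?f _) =>
      apply: (measurableT_comp H)
  | H : forall y, measurable_fun setT (?f y) |- measurable_fun _ (?f _) =>
      exact: H
  | H : forall y, measurable_fun setT (?f y) |- measurable_fun _ (fun x => ?f _ _) =>
      apply: (measurableT_comp (H _))
  | |- measurable_fun _ (fun x => fst _) =>
      apply: (measurableT_comp measurable_fst)
  | |- measurable_fun _ (fun x => snd _) =>
      apply: (measurableT_comp measurable_snd)
  end.
Ltac meas := repeat meas1.

Lemma measurable_bool_set d (T : measurableType d) (b : T -> bool) :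
  measurable_fun setT b -> measurable [set w | b w].
Proof.
by move=> mb; rewrite -[X in measurable X]setTI; exact: (mb _ [set true]).
Qed.

(** * Integrals of nonnegative functions *)

Section ge0_integral.
Local Open Scope ereal_scope.
Context d (T : measurableType d) (R : realType)
  (mu : {sigma_finite_measure set T -> \bar R}).

Lemma le_ge0_integral (f g : T -> \bar R) :
  measurable_fun setT f -> measurable_fun setT g ->
  (forall x, 0 <= f x) -> (forall x, f x <= g x) ->
  \int[mu]_x f x <= \int[mu]_x g x.
Proof. by move=> mf mg f0 fg; apply: ge0_le_integral. Qed.

Lemma measurable_integral_param d' (S : measurableType d')
    (f : S -> T -> \bar R) :
  measurable_fun setT (fun p : S * T => f p.1 p.2) -> (forall s x, 0 <= f s x) ->
  measurable_fun setT (fun s => \int[mu]_x f s x).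
Proof.
move=> mf f0.
by apply: (@measurable_fun_fubini_tonelli_F _ _ _ _ _ mu (fun p : S * T => f p.1 p.2)).
Qed.

Lemma exchange_ge0_integral d' (S : measurableType d')
    (nu : {sigma_finite_measure set S -> \bar R}) (f : S -> T -> \bar R) :
  measurable_fun setT (fun p : S * T => f p.1 p.2) -> (forall s x, 0 <= f s x) ->
  \int[nu]_s \int[mu]_x f s x = \int[mu]_x \int[nu]_s f s x.
Proof.
move=> mf f0.
by apply: (@fubini_tonelli _ _ _ _ _ nu mu (fun p : S * T => f p.1 p.2)).
Qed.

End ge0_integral.

Section probability_integral.
Local Open Scope ereal_scope.
Context d (T : measurableType d) (R : realType) (P : probability T R).

Lemma integral_cst_probability (k : \bar R) : \int[P]_x k = k.
Proof.
by rewrite (_ : (fun=> k) = cst k)// integral_cst// [X in _ * X]probability_setT mule1.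
Qed.

Lemma integral_probability (A : T -> bool) : measurable_fun setT A ->
  \int[P]_x (if A x then 1 else 0) = P [set x | A x].
Proof.
move=> mA; have mA' : measurable [set x | A x].
  by rewrite -[X in measurable X]setTI; exact: mA.
rewrite -[in RHS](setIT [set x | A x]) -integral_indic//; apply: eq_integral => x _.
by rewrite indicE; case: ifPn => Ax; [rewrite mem_set|rewrite memNset//=; exact/negP].
Qed.

End probability_integral.

(* [exceed P X Z n x] is the probability that [S_k + Z_(k+1) > x] for some
   [k < n], where [S] is the random walk whose steps are copies of [X]: the
   recursion conditions on the first step, so that only the law of [(X, Z)]
   is needed. *)
Fixpoint exceed d (T : measurableType d) (R : realType) (P : probability T R)
    (X Z : T -> R) (n : nat) (x : R) : \bar R :=
  if n is m.+1 then
    (\int[P]_w (if (x < Z w)%R then 1 else exceed P X Z m (x - X w)%R))%E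
  else 0%E.

(* [potential P X psi n y] is the expectation of the sum of [psi] over the
   first [n] positions of the walk started at [y]. *)
Fixpoint potential d (T : measurableType d) (R : realType) (P : probability T R)
    (X : T -> R) (psi : R -> \bar R) (n : nat) (y : R) : \bar R :=
  if n is m.+1 then (psi y + \int[P]_w potential P X psi m (y + X w)%R)%E
  else 0%E.

Section exceed_potential.
Local Open Scope ereal_scope.
Context d (T : measurableType d) (R : realType) (P : probability T R)
  (X Z : T -> R).
Hypotheses (mX : measurable_fun setT X) (mZ : measurable_fun setT Z).
Local Notation u := (exceed P X Z).
Implicit Type psi : R -> \bar R.

Lemma exceedS n x :
  u n.+1 x = \int[P]_w (if (x < Z w)%R then 1 else u n (x - X w)%R).
Proof. by []. Qed.

Lemma exceed_ge0 n x : 0 <= u n x.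
Proof.
elim: n x => //= n ih x; apply: integral_ge0 => w _.
by case: ifP => //; rewrite ih.
Qed.

Lemma measurable_exceed n : measurable_fun setT (u n).
Proof.
elim: n => [|n ih] /=; first exact: measurable_cst.
apply: measurable_integral_param; first by meas.
by move=> s x; case: ifP => // _; rewrite exceed_ge0.
Qed.

Lemma exceed_le1 n x : u n x <= 1.
Proof.
elim: n x => //= n ih x.
rewrite -[leRHS](integral_cst_probability P); apply: le_ge0_integral.
- have := measurable_exceed n; by move=> ?; meas.
- by meas.
- by move=> w; case: ifP => // _; exact: exceed_ge0.
- by move=> w; case: ifP.
Qed.

Lemma exceed_nonincr n x y : (x <= y)%R -> u n y <= u n x.
Proof.
elim: n x y => //= n ih x y xy; have ? := measurable_exceed n.
apply: le_ge0_integral; [by meas|by meas| |].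
- by move=> w; case: ifP => // _; exact: exceed_ge0.
- move=> w; case: ifPn => yZ; first by rewrite ifT ?(le_lt_trans xy yZ).
  case: ifPn => // _; first exact: exceed_le1.
  by apply: ih; rewrite lerD2r.
Qed.

Lemma exceed_nondecr n x : u n x <= u n.+1 x.
Proof.
elim: n x => [|n ih] x; first exact: exceed_ge0.
rewrite (exceedS n.+1) (exceedS n).
have ? := measurable_exceed n; have ? := measurable_exceed n.+1.
apply: le_ge0_integral; [by meas|by meas| |].
- by move=> w; case: ifP => // _; exact: exceed_ge0.
- by move=> w; case: ifPn => // _; exact: ih.
Qed.

Lemma exceed_homo m n x : (m <= n)%N -> u m x <= u n x.
Proof.
move=> /subnK <-; elim: (n - m)%N => // k ih.
by rewrite addSn (le_trans ih)//; exact: exceed_nondecr.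
Qed.

Lemma potentialS psi n y :
  potential P X psi n.+1 y = psi y + \int[P]_w potential P X psi n (y + X w)%R.
Proof. by []. Qed.

Lemma potential_ge0 psi n y : (forall y, 0 <= psi y) ->
  0 <= potential P X psi n y.
Proof.
move=> psi0; elim: n y => //= n ih y.
by apply: adde_ge0 => //; apply: integral_ge0 => w _; exact: ih.
Qed.

Lemma potential0 n y : potential P X (cst 0) n y = 0.
Proof.
by elim: n y => //= n ih y; rewrite add0e integral0_eq.
Qed.

Lemma measurable_potential_param d' (S : measurableType d')
    (psi : S -> R -> \bar R) n :
  measurable_fun setT (fun p : S * R => psi p.1 p.2) ->
  (forall s y, 0 <= psi s y) ->
  measurable_fun setT (fun p : S * R => potential P X (psi p.1) n p.2).
Proof.
move=> mpsi psi0; elim: n => [|n ih] /=; first exact: measurable_cst.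
apply: emeasurable_funD => //.
apply: (@measurable_integral_param _ _ _ P _ (S * R)%type
  (fun p w => potential P X (psi p.1) n (p.2 + X w)%R)).
  pose h (q : (S * R) * T) := (q.1.1, (q.1.2 + X q.2)%R).
  have mh : measurable_fun setT h by rewrite /h; meas.
  exact: (measurableT_comp ih mh).
by move=> s x; exact: potential_ge0.
Qed.

Lemma measurable_potential psi n : measurable_fun setT psi ->
  (forall y, 0 <= psi y) -> measurable_fun setT (potential P X psi n).
Proof.
move=> mpsi psi0.
have := @measurable_potential_param _ unit (fun=> psi) n.
move=> /(_ _)/(_ (fun=> psi0)) h.
have {h} mh : measurable_fun setT (fun p : unit * R => potential P X psi n p.2).
  by apply: h; exact: (measurableT_comp mpsi measurable_snd).
have mt : measurable_fun setT (fun y : R => (tt, y)) by meas.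
exact: (measurableT_comp mh mt).
Qed.

Lemma potentialD psi1 psi2 n y : measurable_fun setT psi1 ->
  measurable_fun setT psi2 ->
  (forall y, 0 <= psi1 y) -> (forall y, 0 <= psi2 y) ->
  potential P X (fun z => psi1 z + psi2 z) n y =
  potential P X psi1 n y + potential P X psi2 n y.
Proof.
move=> m1 m2 p1 p2; elim: n y => [|n ih] y /=; first by rewrite adde0.
have ? := measurable_potential n m1 p1.
have ? := measurable_potential n m2 p2.
under eq_integral do rewrite ih.
rewrite ge0_integralD//; [|by move=> w _; exact: potential_ge0|by meas
  |by move=> w _; exact: potential_ge0|by meas].
by rewrite addeACA.
Qed.

Lemma potentialZ (k : R) psi n y : (0 <= k)%R -> measurable_fun setT psi ->
  (forall y, 0 <= psi y) ->
  potential P X (fun z => k%:E * psi z) n y = k%:E * potential P X psi n y.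
Proof.
move=> k0 m1 p1; elim: n y => [|n ih] y /=; first by rewrite mule0.
have ? := measurable_potential n m1 p1.
under eq_integral do rewrite ih.
rewrite ge0_integralZl//; [|by meas|by move=> w _; exact: potential_ge0].
by rewrite [RHS]ge0_muleDr// integral_ge0// => w _; exact: potential_ge0.
Qed.

Lemma le_potential psi1 psi2 n y : measurable_fun setT psi1 ->
  measurable_fun setT psi2 ->
  (forall y, 0 <= psi1 y) -> (forall y, psi1 y <= psi2 y) ->
  potential P X psi1 n y <= potential P X psi2 n y.
Proof.
move=> m1 m2 p1 p12; elim: n y => //= n ih y.
have p2 z : 0 <= psi2 z by exact: le_trans (p12 z).
have ? := measurable_potential n m1 p1.
have ? := measurable_potential n m2 p2.
apply: leeD => //; apply: le_ge0_integral; [by meas|by meas| |by move=> w].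
by move=> w; exact: potential_ge0.
Qed.

(** The potential is additive in [psi], so Tonelli applies at each step. This permits fixing the
    size of a jump first, which leaves the potential of an interval. *)
Lemma potential_integral d' (S : measurableType d')
    (nu : {sigma_finite_measure set S -> \bar R}) (psi : S -> R -> \bar R) n y :
  measurable_fun setT (fun p : S * R => psi p.1 p.2) ->
  (forall s y, 0 <= psi s y) ->
  potential P X (fun z => \int[nu]_s psi s z) n y =
  \int[nu]_s potential P X (psi s) n y.
Proof.
move=> mpsi psi0; elim: n y => [|n ih] y /=; first by rewrite integral0.
have mp := measurable_potential_param n mpsi psi0.
have msec (z : R) : measurable_fun setT (fun s : S => (s, z)) by meas.
rewrite ge0_integralD//; last 3 first.
- exact: (measurableT_comp mpsi (msec y)).
- by move=> s _; apply: integral_ge0 => w _; exact: potential_ge0.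
- apply: measurable_integral_param; last by move=> s w; exact: potential_ge0.
  have mh : measurable_fun setT (fun p : S * T => (p.1, (y + X p.2)%R)) by meas.
  exact: (measurableT_comp mp mh).
congr (_ + _); rewrite (eq_integral (fun w =>
  \int[nu]_s potential P X (psi s) n (y + X w)%R)) => [|w _]; last exact: ih.
apply/esym/exchange_ge0_integral; last by move=> s w; exact: potential_ge0.
have mh : measurable_fun setT (fun p : S * T => (p.1, (y + X p.2)%R)) by meas.
exact: (measurableT_comp mp mh).
Qed.

End exceed_potential.

(** * Potential of a random walk with negative drift *)

Section negative_drift.
Local Open Scope ereal_scope.
Context d (T : measurableType d) (R : realType) (P : probability T R).

Lemma integral_affine (g : T -> R) (m k l : R) :
  P.-integrable setT (EFin \o g) -> \int[P]_w (g w)%:E = m%:E ->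
  \int[P]_w (k * g w + l)%:E = (k * m + l)%:E.
Proof.
move=> ig gm; under eq_integral do rewrite EFinD EFinM.
rewrite integralD//=; last 2 first.
- exact: integrableZl.
- exact: finite_measure_integrable_cst.
rewrite integralZl// gm integral_cst_probability.
by rewrite EFinD EFinM.
Qed.

Context (X Z : T -> R).
Hypotheses (mX : measurable_fun setT X) (mZ : measurable_fun setT Z).
Local Notation u := (exceed P X Z).
Local Notation v := (exceed P X X).

(* The probability that one of the first [n.+1] positions of the walk, time [0]
   included, exceeds [x]. *)
Definition reach n (x : R) : \bar R := if (x < 0)%R then 1 else v n x.

Lemma reach_ge0 n x : 0 <= reach n x.
Proof. by rewrite /reach; case: ifP => // _; exact: exceed_ge0. Qed.

Lemma measurable_reach n : measurable_fun setT (reach n).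
Proof. by have ? := measurable_exceed P mX mX n; rewrite /reach; meas. Qed.

Lemma integral_reach n x : \int[P]_w reach n (x - X w)%R = v n.+1 x.
Proof. by apply: eq_integral => w _; rewrite /reach subr_lt0. Qed.

Lemma integrable_maxr_cst (l : R) :
  P.-integrable setT (EFin \o X) ->
  P.-integrable setT (EFin \o (fun w => Num.max (X w) l)).
Proof.
move=> iX.
apply: (@le_integrable _ _ _ _ _ _ _ (EFin \o (fun w => `|X w| + `|l|)%R)) => //.
- by rewrite /comp; meas.
- move=> w _; rewrite /= lee_fin (@ger0_norm _ (_ + _)) ?addr_ge0//.
  by case: (leP (X w) l) => _; rewrite ?lerDl ?lerDr.
- have -> : EFin \o (fun w => `|X w| + `|l|)%R =
    (abse \o (EFin \o X)) \+ (EFin \o cst `|l|%R) by apply/funext.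
  apply: integrableD => //; first exact: integrable_abse.
  exact: finite_measure_integrable_cst.
Qed.

(* The two bounds are proved together: to the left of [- t] the potential is at
   most the probability of coming back times its supremum, and to the right of
   [- t - K] a linear function of the starting point is a supersolution. *)
Lemma potential_interval_bounds (K L q a t B : R) n y :
  (0 <= K)%R -> (0 <= L)%R -> (0 <= q)%R -> (q < 1)%R -> (0 < a)%R ->
  (forall n, v n K <= q%:E) -> P.-integrable setT (EFin \o X) ->
  \int[P]_w (Num.max (X w) (- L))%:E = (- a)%:E -> (- t <= B)%R ->
  let M := (a^-1 * (B + t + K + L) / (1 - q))%R in
  let f := fun y : R => if ((- t < y) && (y <= B))%R then 1 else 0 : \bar R in
  potential P X f n y <= M%:E * reach n (- t - y)%R /\
  potential P X f n y <=
    (a^-1 * Num.max (Num.min y B + t + K + L) 0 + q * M)%:E.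
Proof.
move=> K0 L0 q0 q1 a0 vq iX Xa tB M f.
have D0 : (0 <= B + t + K + L)%R by lra.
have M0 : (0 <= M)%R.
  by rewrite /M divr_ge0 ?mulr_ge0 ?invr_ge0 ?subr_ge0 ?(ltW q1) ?(ltW a0).
(* [M] is the fixed point of the second bound at [B]: the value of the linear part there, plus
   [q * M] for a return from far below. *)
have ME : (a^-1 * (B + t + K + L) + q * M = M)%R.
  by rewrite /M; field; rewrite (lt0r_neq0 a0) subr_eq0 gt_eqF.
have a'0 : (0 <= a^-1)%R by rewrite invr_ge0 ltW.
have pos0 (z : R) : (0 <= Num.max z 0)%R by rewrite le_max lexx orbT.
have mf : measurable_fun setT f by rewrite /f; meas.
have f0 z : 0 <= f z by rewrite /f; case: ifP.
elim: n y => [|n ih] y.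
  split; first by rewrite mule_ge0// ?lee_fin// reach_ge0.
  by rewrite /= lee_fin addr_ge0// mulr_ge0// pos0.
have mp := measurable_potential P mX n mf f0.
have mr := measurable_reach n.
have back : (y <= - t)%R ->
    potential P X f n.+1 y <= M%:E * v n.+1 (- t - y)%R.
  move=> yt; rewrite -integral_reach potentialS {1}/f ltNge yt/= add0e.
  rewrite -ge0_integralZl//; last 2 first.
  - by meas.
  - by move=> w _; exact: reach_ge0.
  apply: le_ge0_integral.
  - by meas.
  - by meas.
  - by move=> w; exact: potential_ge0.
  - by move=> w; have [+ _] := ih (y + X w)%R; rewrite opprD addrA.
have lin : potential P X f n.+1 y <=
    (a^-1 * Num.max (Num.min y B + t + K + L) 0 + q * M)%:E.
  (* From here the walk has to climb by at least [K] to come back above [- t], which has probability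
     at most [q]; this gives the term [q * M]. *)
  have [ytK|ytK] := leP y (- t - K)%R.
    have yt : (y <= - t)%R by lra.
    apply: (le_trans (back yt)).
    apply: (@le_trans _ _ (M * q)%:E).
      rewrite (EFinM M q); apply: lee_wpmul2l; rewrite ?lee_fin//; apply: le_trans (vq n.+1).
      by apply: exceed_nonincr => //; lra.
    by rewrite lee_fin mulrC lerDr mulr_ge0// pos0.
  have nn w : 0 <= potential P X f n (y + X w)%R by exact: potential_ge0.
  have bd w := (ih (y + X w)%R).2.
  (* Above [B] nothing is collected, and because of the minimum with [B] the bound after a step is
     at most the bound at [y]. *)
  have [yB|By] := leP y B; last first.
    rewrite potentialS {1}/f (leNgt y) By andbF add0e.
    rewrite -[leRHS](integral_cst_probability P); apply: le_ge0_integral => //.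
    - by meas.
    - move=> w; apply: (le_trans (bd w)); rewrite lee_fin lerD2r.
      rewrite ler_pM2l ?invr_gt0//.
      rewrite ge_max le_max; apply/andP; split; last by rewrite le_max lexx orbT.
      by rewrite !lerD2r ge_min lexx orbT.
  have -> : Num.max (y + t + K + L)%R 0%R = (y + t + K + L)%R.
    by apply/max_idPl; lra.
  (* Since [y + t + K > 0], the positive part after one step is at most [y + t + K + L] plus the
     truncated step. The mean [- a] of the latter, divided by [a], pays for the [1] collected at
     [y]. *)
  pose h w := (a^-1 * (Num.max (X w) (- L)) +
    (a^-1 * (y + t + K + L) + q * M))%R.
  rewrite potentialS; apply: (@le_trans _ _ (1 + \int[P]_w (h w)%:E)).
    apply: leeD; first by rewrite /f; case: ifP.
    apply: le_ge0_integral => //.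
    - by meas.
    - by rewrite /h; meas.
    - move=> w; apply: (le_trans (bd w)); rewrite lee_fin /h addrA lerD2r.
      rewrite -mulrDr ler_pM2l ?invr_gt0//.
      have : (Num.min (y + X w) B <= y + X w)%R by rewrite ge_min lexx.
      rewrite ge_max; case: (leP (X w)) => XL; lra.
  rewrite (integral_affine _ _ (integrable_maxr_cst (- L)%R iX) Xa) -EFinD lee_fin.
  by rewrite mulrN mulVf ?lt0r_neq0//; lra.
split => //; rewrite /reach subr_lt0; case: ifPn => yt; last first.
  by apply: back; rewrite leNgt.
rewrite mule1; apply: (le_trans lin); rewrite lee_fin -[leRHS]ME lerD2r.
by rewrite ler_pM2l ?invr_gt0// ge_max D0 andbT !lerD2r ge_min lexx orbT//.
Qed.

End negative_drift.

(** For integrable [Z] this is the integral of its tail over [[x, oo)]. Written as an expectation,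
    it can be estimated pointwise in [Z]. *)
Definition excess d (T : measurableType d) (R : realType) (P : probability T R)
    (Z : T -> R) (x : R) : R :=
  fine (\int[P]_w (Num.max (Z w - x) 0)%:E)%E.

Section excess.
Local Open Scope ereal_scope.
Context d (T : measurableType d) (R : realType) (P : probability T R)
  (Z : T -> R).
Hypotheses (mZ : measurable_fun setT Z) (iZ : P.-integrable setT (EFin \o Z)).

Lemma integrable_excess x :
  P.-integrable setT (EFin \o (fun w => Num.max (Z w - x) 0)%R).
Proof.
rewrite (_ : (fun w => _) = (fun w => Num.max (Z w) x - x)%R); last first.
  by apply/funext => w; rewrite /= -(subrr x) addr_maxl.
rewrite (_ : EFin \o _ = (EFin \o (fun w => Num.max (Z w) x)) \- (EFin \o cst x)).
  apply: integrableB => //; first exact: integrable_maxr_cst.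
  exact: finite_measure_integrable_cst.
by apply/funext.
Qed.

Lemma excessE x : (excess P Z x)%:E = \int[P]_w (Num.max (Z w - x) 0)%:E.
Proof.
rewrite /excess fineK//.
exact: (integrable_fin_num measurableT (integrable_excess x)).
Qed.

Lemma excess_ge0 x : (0 <= excess P Z x)%R.
Proof.
apply: fine_ge0; apply: integral_ge0 => w _.
by rewrite lee_fin le_max lexx orbT.
Qed.

Lemma excess_nonincr x y : (x <= y)%R -> (excess P Z y <= excess P Z x)%R.
Proof.
move=> xy; rewrite -lee_fin !excessE; apply: le_ge0_integral.
- by meas.
- by meas.
- by move=> w; rewrite lee_fin le_max lexx orbT.
- move=> w; rewrite lee_fin ge_max !le_max lexx orbT andbT.
  by rewrite lerD2l lerN2 xy.
Qed.

(** The indicator of [x < Z] is at most the positive part of [Z - (x - 1)] minus that of [Z - x]. So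
    [D] multiplies only a difference of excesses, which long-tailedness later makes negligible. *)
Lemma integral_excess (x D : R) : (0 <= D)%R ->
  \int[P]_w (if (x < Z w)%R then Z w - x + D else 0)%:E <=
  (excess P Z x + D * (excess P Z (x - 1) - excess P Z x))%:E.
Proof.
move=> D0; have D' : (0 <= (1 - D) + D)%R by lra.
pose h w := (Num.max (Z w - x) 0 +
  D * (Num.max (Z w - (x - 1)) 0 - Num.max (Z w - x) 0))%R.
have -> : (excess P Z x + D * (excess P Z (x - 1) - excess P Z x))%:E =
    \int[P]_w (h w)%:E.
  rewrite EFinD EFinM EFinB !excessE.
  under [RHS]eq_integral do rewrite /h EFinD EFinM EFinB.
  have i1 := integrable_excess x; have i2 := integrable_excess (x - 1)%R.
  have i3 := integrableB measurableT i2 i1.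
  rewrite integralD//; last exact: (integrableZl measurableT D i3).
  rewrite integralZl// integralB//.
apply: le_ge0_integral.
- by meas.
- by rewrite /h; meas.
- by move=> w; rewrite lee_fin; case: ifPn => // ?; lra.
- move=> w; rewrite lee_fin /h.
  case: ifPn => xZ; last first.
    have -> : Num.max (Z w - x)%R 0%R = 0%R by apply/max_idPr; lra.
    by rewrite subr0 add0r mulr_ge0// le_max lexx orbT.
  have -> : Num.max (Z w - x)%R 0%R = (Z w - x)%R by apply/max_idPl; lra.
  have -> : Num.max (Z w - (x - 1))%R 0%R = (Z w - (x - 1))%R.
    by apply/max_idPl; lra.
  by lra.
Qed.

(** Between the levels [x] and [x + k] the positive part loses at most [k], and only when [Z > x].
    Together with [tail_step] this compares the excess with Riemann sums of the tail from both
    sides. *)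
Lemma excess_step (x k : R) : (0 <= k)%R ->
  (excess P Z x)%:E <= k%:E * P [set w | (x < Z w)%R] + (excess P Z (x + k))%:E.
Proof.
move=> k0; rewrite -integral_probability; last by meas.
rewrite !excessE -ge0_integralZl//; last 2 first.
- by meas.
- by move=> w _; case: ifP.
rewrite -ge0_integralD//; last 4 first.
- by move=> w _; case: ifP => _; rewrite ?mule0// mule1 lee_fin.
- by meas.
- by move=> w _; rewrite lee_fin le_max lexx orbT.
- by meas.
apply: le_ge0_integral.
- by meas.
- by meas.
- by move=> w; rewrite lee_fin le_max lexx orbT.
- move=> w; case: ifPn => xZ; rewrite ?mule1 ?mule0 ?add0e -?EFinD lee_fin;
    case: (leP (Z w - x)%R 0%R) => h1;
    case: (leP (Z w - (x + k))%R 0%R) => h2; lra.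
Qed.

Lemma tail_step (x k : R) : (0 <= k)%R ->
  k%:E * P [set w | (x + k < Z w)%R] + (excess P Z (x + k))%:E <=
  (excess P Z x)%:E.
Proof.
move=> k0; rewrite -integral_probability; last by meas.
rewrite !excessE -ge0_integralZl//; last 2 first.
- by meas.
- by move=> w _; case: ifP.
rewrite -ge0_integralD//; last 4 first.
- by move=> w _; case: ifP => _; rewrite ?mule0// mule1 lee_fin.
- by meas.
- by move=> w _; rewrite lee_fin le_max lexx orbT.
- by meas.
apply: le_ge0_integral.
- by meas.
- by meas.
- move=> w; apply: adde_ge0.
    by case: ifP => _; rewrite ?mule0// mule1 lee_fin.
  by rewrite lee_fin le_max lexx orbT.
- move=> w; case: ifPn => xZ; rewrite ?mule1 ?mule0 ?add0e -?EFinD lee_fin;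
    case: (leP (Z w - x)%R 0%R) => h1;
    case: (leP (Z w - (x + k))%R 0%R) => h2; lra.
Qed.

Lemma excess_cvg0 (e : R) : (0 < e)%R ->
  exists x0, forall x, (x0 <= x)%R -> (excess P Z x < e)%R.
Proof.
move=> e0.
have h : (excess P Z n%:R)%:E @[n --> \oo] --> \int[P]_w (cst 0 w).
  under eq_fun do rewrite excessE.
  apply: (@dominated_cvg _ _ _ P setT measurableT
    (fun n w => (Num.max (Z w - n%:R) 0)%:E) (cst 0)
    (EFin \o (fun w => Num.max (Z w - 0) 0)%R)) => //.
  - by move=> n; meas.
  - move=> w _; apply: cvg_near_cst.
    have [m hm] : exists m : nat, (Z w < m%:R)%R.
      exists (Num.trunc `|Z w|).+1.
      by rewrite (le_lt_trans (ler_norm _))// truncnS_gt.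
    exists m => // n /= mn; congr EFin; apply/max_idPr.
    by rewrite subr_le0 (le_trans (ltW hm))// ler_nat.
  - exact: integrable_excess.
  - move=> n w _; rewrite /= lee_fin ger0_norm; last by rewrite le_max lexx orbT.
    by case: (leP (Z w - n%:R)%R 0%R) => h1; case: (leP (Z w - 0)%R 0%R) => h2;
      have := ler0n R n; lra.
rewrite integral_cst_probability in h.
have /fine_cvg := h; rewrite (_ : fine \o _ = fun n => excess P Z n%:R)//.
move=> /cvgrPdist_lt /(_ e e0) [n _ hn].
exists n%:R => x nx; apply: le_lt_trans (excess_nonincr nx) _.
by have := hn n (leqnn n); rewrite /= sub0r normrN ger0_norm// excess_ge0.
Qed.

End excess.

(** * Expected number of large jumps *)

Section comparison.
Local Open Scope ereal_scope.
Context d (T : measurableType d) (R : realType) (P : probability T R)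
  (X Z : T -> R).
Hypotheses (mX : measurable_fun setT X) (mZ : measurable_fun setT Z).
Local Notation u := (exceed P X Z).
Local Notation v := (exceed P X X).

(** The data of [potential_interval_bounds]. Here [- a] is the mean of the step truncated at [- L],
    not of the step itself, and [q] bounds the probability of ever climbing by [K]. *)
Definition drift_bound (K L q a : R) :=
  [/\ (0 <= K)%R, (0 <= L)%R, (0 <= q < 1)%R /\ (forall n, v n K <= q%:E) &
      (0 < a)%R /\ \int[P]_w (Num.max (X w) (- L))%:E = (- a)%:E].

(* The expected number of times [k < n] at which the walk started at [y] is at
   most [B] and [S_k + Z_(k+1) > s]. *)
Definition jump_potential (s B : R) (n : nat) (y : R) : \bar R :=
  potential P X (fun y => \int[P]_w
    (if ((s - Z w < y) && (y <= B))%R then 1 else 0)) n y.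

Lemma measurable_jump (s B : R) : measurable_fun setT (fun y : R => \int[P]_w
  (if ((s - Z w < y) && (y <= B))%R then 1 else 0)).
Proof.
apply: measurable_integral_param; first by meas.
by move=> y w; case: ifP.
Qed.

Lemma jump_potential_ge0 s B n y : 0 <= jump_potential s B n y.
Proof.
apply: potential_ge0 => z; apply: integral_ge0 => w _; by case: ifP.
Qed.

Lemma potential_interval_le (K L q a t B : R) n y :
  drift_bound K L q a -> P.-integrable setT (EFin \o X) -> (- t <= B)%R ->
  potential P X (fun y => if ((- t < y) && (y <= B))%R then 1 else 0) n y <=
  (a^-1 * (B + t + K + L) / (1 - q))%:E.
Proof.
move=> [K0 L0 [/andP[q0 q1] vq] [a0 aE]] iX tB.
have [_ h] := potential_interval_bounds mX n y K0 L0 q0 q1 a0 vq iX aE tB.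
apply: (le_trans h); rewrite lee_fin; set M := (_ / _)%R.
have {2}-> : M = (a^-1 * (B + t + K + L) + q * M)%R.
  by rewrite /M; field; rewrite (lt0r_neq0 a0) subr_eq0 gt_eqF.
rewrite lerD2r ler_pM2l ?invr_gt0// ge_max; apply/andP; split; last by lra.
by rewrite !lerD2r ge_min lexx orbT.
Qed.

(** For a fixed jump the potential is that of the interval [(s - Z w, B]], of length
    [Z w - (s - B)]. Averaging over the jump turns the length into an excess and the overhead
    [K + L] into a difference of excesses. *)
Lemma jump_potential_le (K L q a s B : R) n y :
  drift_bound K L q a -> P.-integrable setT (EFin \o X) ->
  P.-integrable setT (EFin \o Z) ->
  jump_potential s B n y <= (a^-1 / (1 - q) * (excess P Z (s - B) +
    (K + L) * (excess P Z (s - B - 1) - excess P Z (s - B))))%:E.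
Proof.
move=> db iX iZ; rewrite /jump_potential.
have [K0 L0 [/andP[q0 q1] vq] [a0 aE]] := db.
have C0 : (0 <= a^-1 / (1 - q))%R by rewrite divr_ge0 ?invr_ge0 ?subr_ge0 ?ltW.
have mh : measurable_fun setT (fun p : T * R =>
    if ((s - Z p.1 < p.2) && (p.2 <= B))%R then 1 else 0 : \bar R) by meas.
have h0 w z : 0 <= (if ((s - Z w < z) && (z <= B))%R then 1 else 0 : \bar R).
  by case: ifP.
rewrite (potential_integral P mX P n y mh h0).
have := measurable_potential_param P mX n mh h0.
set pot := (X in measurable_fun _ X) => mpot.
rewrite EFinM; apply: (@le_trans _ _ ((a^-1 / (1 - q))%:E *
    \int[P]_w (if (s - B < Z w)%R then Z w - (s - B) + (K + L) else 0)%:E)).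
  rewrite -ge0_integralZl//; last 2 first.
  - by meas.
  - by move=> w _; rewrite lee_fin; case: ifPn => // ?; lra.
  apply: le_ge0_integral.
  - have ms : measurable_fun setT (fun w : T => (w, y)) by meas.
    exact: (measurableT_comp mpot ms).
  - by meas.
  - by move=> w; exact: potential_ge0.
  - move=> w; case: ifPn => [sZ|].
      have tB : (- (Z w - s) <= B)%R by lra.
      have -> : (fun z => if ((s - Z w < z) && (z <= B))%R then 1 else 0) =
          (fun z => if ((- (Z w - s) < z) && (z <= B))%R then 1 else 0 : \bar R).
        by apply/funext => z; rewrite opprB.
      apply: le_trans (potential_interval_le n y db iX tB) _.
      rewrite -EFinM lee_fin [leLHS](_ : _ = a^-1 / (1 - q) *
        (Z w - (s - B) + (K + L)))%R//; ring.
    rewrite -leNgt => Zs; rewrite (_ : (fun z => _) = cst 0); last first.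
      apply/funext => z /=; case: ifPn => // /andP[h1 h2]; exfalso; lra.
    by rewrite mule0 potential0.
by apply: lee_wpmul2l => //; apply: integral_excess => //; lra.
Qed.

End comparison.

Section comparison_principles.
Local Open Scope ereal_scope.
Context d (T : measurableType d) (R : realType) (P : probability T R)
  (X Z : T -> R).
Hypotheses (mX : measurable_fun setT X) (mZ : measurable_fun setT Z).
Local Notation u := (exceed P X Z).
Local Notation v := (exceed P X X).

(* Stop the walk when it first jumps above [A], to [z], say: what is left then
   exceeds [x] with probability at most [phi z + r]. *)
Lemma exceed_le_potential (x A r : R) (phi : R -> \bar R) (N : nat) :
  (forall w, X w <= Z w)%R -> measurable_fun setT phi ->
  (forall z, 0 <= phi z) -> (0 <= r)%R -> (A <= x)%R ->
  (forall j z, (j < N)%N -> (A < z)%R -> (z <= x)%R ->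
    u j (x - z) <= phi z + r%:E) ->
  (forall z, (x < z)%R -> 1 <= phi z + r%:E) ->
  forall j y, (j <= N)%N -> (y <= A)%R ->
  u j (x - y) <= potential P X (fun y => \int[P]_w
      (if ((A - Z w < y) && (y <= A))%R then phi (y + Z w)%R else 0)) j y +
    r%:E * u j (A - y).
Proof.
move=> XZ mphi phi0 r0 Ax uphi phi1.
set psi := fun y : R => _.
have psi0 z : 0 <= psi z by apply: integral_ge0 => w _; case: ifP.
have mpsi : measurable_fun setT psi.
  by apply: measurable_integral_param; [by meas|move=> y w; case: ifP].
elim=> [|j ih] y jN yA; first by rewrite /= mule0 adde0.
have {}ih := fun z => ih z (ltnW jN).
have mp := measurable_potential P mX j mpsi psi0.
have mu := measurable_exceed P mX mZ j.
rewrite !exceedS potentialS {1}/psi -ge0_integralD//=; last 4 first.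
- by move=> w _; case: ifP.
- by meas.
- by move=> w _; exact: potential_ge0.
- by meas.
rewrite -ge0_integralZl//; last 2 first.
- by meas.
- by move=> w _; case: ifP => // _; exact: exceed_ge0.
rewrite -ge0_integralD//=; last 4 first.
- move=> w _; apply: adde_ge0; last exact: potential_ge0.
  by case: ifP.
- by meas.
- move=> w _; apply: mule_ge0; first by rewrite lee_fin.
  by case: ifP => // _; exact: exceed_ge0.
- by meas.
apply: le_ge0_integral.
- by meas.
- by meas.
- by move=> w; case: ifP => // _; exact: exceed_ge0.
- move=> w; rewrite yA andbT.
  (* If [y + Z] is above [A], the walk is stopped and its position [y + X] is replaced by the larger
     [y + Z], which only makes exceeding [x] easier. Otherwise [X <= Z] keeps the next position at
     or below [A], and the induction goes on. *)
  have [AyZ|yZA] := ltP (A - y)%R (Z w).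
    have -> : (A - Z w < y)%R by lra.
    rewrite mule1 addeAC; apply: (@le_trans _ _ (phi (y + Z w)%R + r%:E)).
      case: ifPn => [xyZ|]; first by apply: phi1; lra.
      rewrite -leNgt => yZx.
      apply: (@le_trans _ _ (u j (x - (y + Z w))%R)).
        by apply: exceed_nonincr => //; have := XZ w; lra.
      apply: uphi => //; lra.
    by rewrite leeDl// potential_ge0.
  have -> : (A - Z w < y)%R = false by apply/negbTE; rewrite -leNgt; lra.
  have -> : (x - y < Z w)%R = false by apply/negbTE; rewrite -leNgt; lra.
  rewrite add0e -!addrA -!opprD; apply: ih.
  by have := XZ w; lra.
Qed.

(** Unless the walk itself goes above [B], [A] can only be exceeded by a jump from a position at
    most [B], and the probability of such a jump is at most the expected number of them. *)
Lemma exceed_le_reach_jump (A B : R) n y :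
  u n (A - y) <= reach P X n (B - y) + jump_potential P X Z A B n y.
Proof.
elim: n y => [|n ih] y.
  by rewrite /= adde_ge0 ?reach_ge0 ?jump_potential_ge0.
have [yB|By] := leP y B; last first.
  apply: (@le_trans _ _ 1); first exact: exceed_le1.
  by rewrite /reach subr_lt0 By leeDl// jump_potential_ge0.
have mu := measurable_exceed P mX mZ n.
have mr := measurable_reach P mX n.
have mj : measurable_fun setT (jump_potential P X Z A B n).
  apply: measurable_potential => //; first exact: measurable_jump.
  by move=> z; apply: integral_ge0 => w _; case: ifP.
rewrite {1}/reach subr_lt0 (ltNge B) yB/= -/(exceed P X X n.+1 _) -integral_reach.
have -> : jump_potential P X Z A B n.+1 y = \int[P]_w
    (if ((A - Z w < y) && (y <= B))%R then 1 else 0) +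
    \int[P]_w jump_potential P X Z A B n (y + X w)%R by [].
rewrite -ge0_integralD//=; last 4 first.
- by move=> w _; case: ifP.
- by meas.
- by move=> w _; exact: jump_potential_ge0.
- by meas.
rewrite -ge0_integralD//=; last 4 first.
- by move=> w _; exact: reach_ge0.
- by meas.
- move=> w _; apply: adde_ge0; last exact: jump_potential_ge0.
  by case: ifP.
- by meas.
apply: le_ge0_integral.
- by meas.
- by meas.
- by move=> w; case: ifP => // _; exact: exceed_ge0.
- move=> w; rewrite yB andbT.
  have -> : (A - Z w < y)%R = (A - y < Z w)%R by apply/idP/idP; lra.
  case: ifPn => AyZ.
    rewrite addeCA leeDl// adde_ge0 ?reach_ge0 ?jump_potential_ge0//.
  by rewrite add0e -!addrA -!opprD; exact: ih.
Qed.

End comparison_principles.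

(** * Finiteness of the suprema *)

Section tail_vanishes.
Local Open Scope ereal_scope.
Context d (T : measurableType d) (R : realType) (P : probability T R)
  (X Z : T -> R).
Hypotheses (mX : measurable_fun setT X) (mZ : measurable_fun setT Z)
  (iX : P.-integrable setT (EFin \o X)) (iZ : P.-integrable setT (EFin \o Z)).
Local Notation u := (exceed P X Z).
Local Notation v := (exceed P X X).

Lemma integral_truncated (b L : R) : \int[P]_w (X w)%:E = (- b)%:E ->
  \int[P]_w (Num.max (X w) (- L))%:E = (- (b - excess P (fun w => - X w)%R L))%:E.
Proof.
move=> Xb.
have iN : P.-integrable setT (EFin \o (fun w => - X w)%R).
  by rewrite (_ : EFin \o _ = -%E \o (EFin \o X))//; exact: integrableN.
have mN : measurable_fun setT (fun w => - X w)%R by meas.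
rewrite (eq_integral (fun w => (X w)%:E + (Num.max (- X w - L) 0)%:E)%R).
  2: move=> w _; rewrite -EFinD; congr EFin.
  2: by case: (leP (X w)); case: (leP (- X w - L)%R); lra.
rewrite integralD//; last exact: (integrable_excess mN iN L).
by rewrite Xb -(excessE mN iN) -EFinD opprB addrC.
Qed.

Lemma truncated_drift (b e : R) : (0 < e)%R ->
  \int[P]_w (X w)%:E = (- b)%:E ->
  exists L, (0 <= L)%R /\ exists2 a, (b - e < a)%R &
    \int[P]_w (Num.max (X w) (- L))%:E = (- a)%:E.
Proof.
move=> e0 Xb.
have iN : P.-integrable setT (EFin \o (fun w => - X w)%R).
  by rewrite (_ : EFin \o _ = -%E \o (EFin \o X))//; exact: integrableN.
have mN : measurable_fun setT (fun w => - X w)%R by meas.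
have [x0 hx0] := excess_cvg0 mN iN e0.
exists (Num.max x0 0)%R; split; first by rewrite le_max lexx orbT.
exists (b - excess P (fun w => - X w) (Num.max x0 0)%R)%R.
  by rewrite ltrD2l ltrN2 hx0// le_max lexx.
exact: integral_truncated.
Qed.

(** A cruder bound, for the places where the jump only has to be rare or comparable to [Fb] and the
    constant is irrelevant. *)
Lemma jump_potential_le_excess (K L q a s B : R) n y :
  drift_bound P X K L q a ->
  jump_potential P X Z s B n y <=
    (a^-1 / (1 - q) * (1 + K + L) * excess P Z (s - B - 1))%:E.
Proof.
move=> db; apply: (le_trans (jump_potential_le mX mZ s B n y db iX iZ)).
have [K0 L0 [/andP[q0 q1] vq] [a0 aE]] := db.
rewrite lee_fin -[leRHS]mulrA; apply: ler_wpM2l.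
  by rewrite divr_ge0 ?invr_ge0 ?subr_ge0 ?ltW.
have : (excess P Z (s - B) <= excess P Z (s - B - 1))%R.
  by apply: excess_nonincr => //; lra.
have := excess_ge0 P Z (s - B)%R; nra.
Qed.

Lemma jump_potential_small (K L q a B e : R) : (0 < e)%R ->
  drift_bound P X K L q a ->
  exists s0, forall s, (s0 <= s)%R -> forall n y, jump_potential P X Z s B n y <= e%:E.
Proof.
move=> e0 db; have [K0 L0 [/andP[q0 q1] vq] [a0 aE]] := db.
pose C := (a^-1 / (1 - q) * (1 + K + L))%R.
have C0 : (0 < C)%R.
  by rewrite mulr_gt0 ?divr_gt0 ?invr_gt0 ?subr_gt0//; lra.
have [x0 hx0] := excess_cvg0 mZ iZ (divr_gt0 e0 C0).
exists (x0 + B + 1)%R => s hs n y.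
apply: (le_trans (jump_potential_le_excess s B n y db)).
rewrite lee_fin -/C mulrC -ler_pdivlMr// ltW// hx0//; lra.
Qed.

Lemma exceed_small (K L q a : R) : drift_bound P X K L q a ->
  (forall e, (0 < e)%R -> exists2 K, (0 <= K)%R & forall n, v n K <= e%:E) ->
  forall e, (0 < e)%R -> exists2 A, (0 <= A)%R & forall n, u n A <= e%:E.
Proof.
move=> db vsmall e e0; have e2 : (0 < e / 2)%R by lra.
have [B B0 hB] := vsmall _ e2.
have [s0 hs0] := jump_potential_small B e2 db.
exists (Num.max s0 0)%R => [|n]; first by rewrite le_max lexx orbT.
have := @exceed_le_reach_jump _ _ _ P _ _ mX mZ (Num.max s0 0)%R B n 0%R.
rewrite !subr0 => /le_trans; apply.
rewrite [e in e%:E](_ : e = e / 2 + e / 2)%R; last by lra.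
rewrite EFinD; apply: leeD; last by rewrite hs0// le_max lexx.
by rewrite /reach ltNge B0; exact: hB.
Qed.

End tail_vanishes.

Section walk_tail_vanishes.
Local Open Scope ereal_scope.
Context d (T : measurableType d) (R : realType) (P : probability T R) (X : T -> R).
Hypotheses (mX : measurable_fun setT X) (iX : P.-integrable setT (EFin \o X)).
Local Notation v := (exceed P X X).

(** To climb [K + h], the walk must first exceed [0], which has probability at most [p]. An
    overshoot beyond [h] is rare for large [h], and without it [K] is still to be climbed. Iterating
    gives the bounds [p ^+ k], up to an error controlled by the choice of [h]. *)
Lemma exceed_self_small (b p : R) : (0 < b)%R ->
  \int[P]_w (X w)%:E = (- b)%:E -> (0 <= p < 1)%R -> (forall n, v n 0%R <= p%:E) ->
  forall e, (0 < e)%R -> exists2 K, (0 <= K)%R & forall n, v n K <= e%:E.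
Proof.
move=> b0 Xb /andP[p0 p1] vp.
have [L [L0 [a ab aE]]] := truncated_drift mX iX b0 Xb.
(* The estimate at level [0] is already a return estimate, with [K = 0] and [q = p]. *)
have db : drift_bound P X 0 L p a.
  by split => //; split => //; [rewrite p0 p1|lra].
have geo k e : (0 < e)%R ->
    exists2 K, (0 <= K)%R & forall n, v n K <= (p ^+ k + e)%:E.
  elim: k e => [|k ih] e e0.
    exists 0%R => // n; apply: (le_trans (exceed_le1 _ _ _ _ _)) => //.
    by rewrite lee_fin expr0; lra.
  have e2 : (0 < e / 2)%R by lra.
  have [K K0 hK] := ih _ e2.
  have [s0 hs0] := jump_potential_small mX mX iX iX 0 e2 db.
  pose h := Num.max s0 0%R; have h0 : (0 <= h)%R by rewrite le_max lexx orbT.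
  exists (K + h)%R => [|n]; first by rewrite addr_ge0.
  have r0 : (0 <= p ^+ k + e / 2)%R.
    by rewrite addr_ge0 ?exprn_ge0// ltW.
  pose phi z : \bar R := if (h < z)%R then 1 else 0.
  have phi0 z : 0 <= phi z by rewrite /phi; case: ifP.
  have mphi : measurable_fun setT phi by rewrite /phi; meas.
  have key := @exceed_le_potential _ _ _ P _ _ mX mX (K + h)%R 0%R _ phi n
    (fun w => lexx (X w)) mphi phi0 r0 (addr_ge0 K0 h0).
  have {key} := key _ _ n 0%R (leqnn n) (lexx 0%R).
  rewrite !subr0 => key; apply: le_trans (key _ _) _.
  - move=> j z _ z0 zKh; rewrite /phi; case: ifPn => hz.
      by apply: (le_trans (exceed_le1 _ _ _ _ _)) => //; rewrite leeDl.
    rewrite add0e; apply: le_trans (hK j); apply: exceed_nonincr => //.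
    by rewrite -leNgt in hz; lra.
  - by move=> z hz; rewrite /phi ifT ?leeDl//; lra.
  rewrite [leRHS](_ : _ = (e / 2)%:E + ((p ^+ k + e / 2) * p)%:E +
     (e / 2 * (1 - p))%:E); last first.
    by rewrite -!EFinD; congr EFin; rewrite exprS; field.
  rewrite -[leLHS]adde0; apply: leeD; last by rewrite lee_fin; nra.
  apply: leeD; last by rewrite EFinM; apply: lee_wpmul2l.
  apply: le_trans (hs0 h _ n 0%R); last by rewrite /h le_max lexx.
  apply: le_potential => //.
  - apply: measurable_integral_param; first by meas.
    by move=> y w; case: ifP.
  - exact: measurable_jump.
  - by move=> y; apply: integral_ge0 => w _; case: ifP.
  - move=> y; apply: le_ge0_integral.
    + by meas.
    + by meas.
    + by move=> w; case: ifP.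
    + move=> w; case: ifPn => [/andP[h1 h2]|_]; last by case: ifP.
      rewrite /phi; case: ifPn => [h3|_]; last by case: ifP.
      by rewrite ifT// h2 andbT; lra.
move=> e e0; have e2 : (0 < e / 2)%R by lra.
have := cvg_expr (_ : `|p| < 1)%R; rewrite ger0_norm// => /(_ p1).
move=> /cvgrPdist_lt/(_ _ e2)[k _ /(_ k (leqnn k))]; rewrite sub0r normrN => hk.
have [K K0 hK] := geo k _ e2; exists K => // n.
apply: (le_trans (hK n)); rewrite lee_fin.
by move: hk; rewrite ger0_norm ?exprn_ge0//; lra.
Qed.

End walk_tail_vanishes.

(** * Upper bound for a perturbed random walk *)

Lemma asymp_equivP (R : realType) (f g : R -> R) : (forall x, 0 < g x) ->
  asymp_equiv f g <->
  (forall e, 0 < e -> exists x0, forall x, x0 <= x ->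
    (1 - e) * g x <= f x <= (1 + e) * g x).
Proof.
move=> g0; split=> [/cvgrPdist_le fg e e0|fg].
  have [M [_ hM]] := fg e e0; exists (M + 1) => x Mx.
  have /hM : M < x by lra.
  by rewrite /= distrC ler_distl ler_pdivlMr// ler_pdivrMr.
apply/cvgrPdist_le => e e0; have [x0 hx0] := fg e e0.
near=> x; rewrite distrC ler_distl ler_pdivlMr// ler_pdivrMr//.
by apply: hx0; near: x; apply: nbhs_pinfty_ge; rewrite num_real.
Unshelve. all: by end_near. Qed.

(** * Convolution squares *)

Section tail_of_probability.
Context (R : realType) (F : probability R R).
Definition ftail (x : R) : R := fine (tail F x).

Lemma ftailE x : (ftail x)%:E = tail F x.
Proof. by rewrite /ftail fineK// fin_num_measure. Qed.

Lemma ftail_ge0 x : 0 <= ftail x.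
Proof. exact/fine_ge0/measure_ge0. Qed.

Lemma ftail_le1 x : ftail x <= 1.
Proof. by rewrite -lee_fin ftailE probability_le1. Qed.

Lemma ftail_nonincr x y : x <= y -> ftail y <= ftail x.
Proof.
move=> xy; rewrite -lee_fin !ftailE; apply: le_measure; rewrite ?inE//.
by apply: subset_itvr; rewrite bnd_simp.
Qed.

Lemma ftail_integral x :
  tail F x = (\int[F]_y (if (x < y)%R then 1 else 0))%E.
Proof.
have mid : measurable_fun setT (fun y : R => y) by exact: measurable_id.
rewrite integral_probability; last by meas.
congr (F _); apply/seteqP; split => y /=; rewrite in_itv/= andbT//.
Qed.

Lemma tail_convolution x : tail (convolution F F) x = (\int[F]_y tail F (x - y)%R)%E.
Proof.
rewrite /convolution /tail /pushforward/=.
rewrite /product_measure1; apply: eq_integral => y _ /=.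
congr (F _); apply/seteqP; split => z; rewrite /xsection/= inE/= !in_itv/= !andbT.
  by move=> ?; lra.
by move=> ?; lra.
Qed.

End tail_of_probability.

Section convolution_middle.
Local Open Scope ereal_scope.
Context (R : realType) (F : probability R R).
Hypothesis F0 : F `]-oo, 0%R[%classic = 0.
Local Notation Fb := (ftail F).

Lemma probability_half_line : F `[0%R, +oo[%classic = 1.
Proof.
rewrite (_ : `[0%R, +oo[%classic = ~` `]-oo, 0%R[%classic).
  by rewrite probability_setC// F0 sube0.
apply/seteqP; split => y /=; rewrite !in_itv/= andbT leNgt; first by move/negP.
by move=> ?; apply/negP.
Qed.

Lemma ftail_neg x : (x < 0)%R -> Fb x = 1%R.
Proof.
move=> x0; apply/eqP; rewrite -eqe ftailE eq_le probability_le1//=.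
rewrite -probability_half_line; apply: le_measure; rewrite ?inE//.
by apply: subset_itvr; rewrite bnd_simp.
Qed.

(** Split by one summand [y]. For [y > x] the sum exceeds [x], the other summand being nonnegative;
    for [y <= h] it is enough that the other one alone exceeds [x]; the values from [h] to [x - A]
    form the middle part. *)
Lemma convolution_middle (h A x : R) : (0 <= h <= x)%R -> (0 <= A)%R ->
  \int[F]_y (if ((h < y) && (y <= x - A))%R then tail F (x - y) else 0) +
    ((1 - Fb h) * Fb x)%:E + (Fb x)%:E <= tail (convolution F F) x.
Proof.
move=> /andP[h0 hx] A0; rewrite tail_convolution.
have mid : measurable_fun setT (fun y : R => y) by exact: measurable_id.
have mt : measurable_fun setT (tail F) by exact: measurable_tail.
have t0 y : 0 <= tail F y by exact: measure_ge0.
have hE : (1 - Fb h)%:E = \int[F]_y (if ((0 <= y) && (y <= h))%R then 1 else 0).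
  rewrite integral_probability; last by meas.
  have -> : [set y : R | ((0 <= y) && (y <= h))%R] = `[0%R, h]%classic.
    by apply/seteqP; split => y /=; rewrite in_itv.
  apply/eqP; rewrite EFinB ftailE sube_eq ?fin_num_adde_defl ?fin_num_measure//.
  rewrite -measureU//; last first.
    apply/seteqP; split => // y [] /=; rewrite !in_itv/= andbT => /andP[_ h1] h2.
    lra.
  rewrite -(probability_half_line); apply/eqP; congr (F _).
  apply/seteqP; split => y /=; rewrite !in_itv/= !andbT.
    by move=> y0; case: (leP y h) => hy; [left; rewrite y0|right].
  by move=> [/andP[]//|hy]; lra.
rewrite mulrC EFinM hE [X in _ + _ * _ + X]ftailE [X in _ + _ * _ + X]ftail_integral.
rewrite -ge0_integralZl ?lee_fin ?ftail_ge0//; last 2 first.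
- by meas.
- by move=> y _; case: ifP.
rewrite -ge0_integralD//; last 4 first.
- by move=> y _; case: ifP.
- by meas.
- by move=> y _; case: ifP => _; rewrite ?mule0// mule1 lee_fin ftail_ge0.
- by meas.
rewrite -ge0_integralD//; last 4 first.
- move=> y _; apply: adde_ge0; case: ifP => // _; rewrite ?mule0// mule1.
  by rewrite lee_fin ftail_ge0.
- by meas.
- by move=> y _; case: ifP.
- by meas.
apply: le_ge0_integral.
- by meas.
- by meas.
- move=> y; rewrite !adde_ge0//; case: ifP => // _; rewrite ?mule0// mule1.
  by rewrite lee_fin ftail_ge0.
- move=> y; have [xy|yx] := ltP x y.
    have -> : (y <= x - A)%R = false by apply/negbTE; rewrite -ltNge; lra.
    have -> : (y <= h)%R = false by apply/negbTE; rewrite -ltNge; lra.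
    rewrite !andbF mule0 !add0e -ftailE ftail_neg//; lra.
  rewrite adde0; have [hy|yh] := ltP h y.
    rewrite andbF mule0 adde0; by case: ifP.
  rewrite add0e andbT; case: ifP => y0; rewrite ?mule0 ?mule1//.
  by rewrite -ftailE lee_fin ftail_nonincr//; lra.
Qed.

(** The two end pieces use up [(2 - Fb h) * Fb x], so the middle is left with the error: [2 * e]
    from the convolution and [Fb h <= e], in all [3 * e]. *)
Lemma convolution_middle_le (h A x e : R) : (0 <= h <= x)%R -> (0 <= A)%R ->
  (Fb h <= e)%R ->
  (fine (tail (convolution F F) x) <= (1 + e) * (2 * Fb x))%R ->
  \int[F]_y (if ((h < y) && (y <= x - A))%R then tail F (x - y) else 0) <=
  (3 * e * Fb x)%:E.
Proof.
move=> hx A0 Fh hconv; have := convolution_middle hx A0.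
set mid := (X in X + _ + _ <= _) => hmid.
have mid0 : 0 <= mid.
  by apply: integral_ge0 => y _; case: ifP => // _; exact: tail_ge0.
have convE : tail (convolution F F) x = (fine (tail (convolution F F) x))%:E.
  rewrite fineK// tail_convolution.
  rewrite ge0_fin_numE; last by apply: integral_ge0 => y _; exact: tail_ge0.
  apply: (@le_lt_trans _ _ 1); last exact: ltry.
  rewrite -[leRHS](integral_cst_probability F); apply: le_ge0_integral => //.
  - have mt : measurable_fun setT (tail F) by exact: measurable_tail.
    have mid' : measurable_fun setT (fun y : R => y) by exact: measurable_id.
    by meas.
  - by move=> y; exact: tail_le1.
have F1 := ftail_le1 F h; have Fx := ftail_ge0 F x.
rewrite convE in hmid.
have midf : mid \is a fin_num.
  rewrite ge0_fin_numE//.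
  apply: le_lt_trans (ltry (fine (tail (convolution F F) x))).
  by apply: le_trans hmid; rewrite -addeA leeDl// -EFinD lee_fin; nra.
rewrite -(fineK midf) -!EFinD lee_fin in hmid.
rewrite -[leLHS]/mid -(fineK midf) lee_fin; nra.
Qed.

End convolution_middle.

Section upper_bound.
Local Open Scope ereal_scope.
Context d (T : measurableType d) (R : realType) (P : probability T R)
  (X Z : T -> R) (F : probability R R).
Hypotheses (mX : measurable_fun setT X) (mZ : measurable_fun setT Z)
  (iX : P.-integrable setT (EFin \o X)) (iZ : P.-integrable setT (EFin \o Z))
  (XZ : forall w, (X w <= Z w)%R).
Local Notation u := (exceed P X Z).
Local Notation v := (exceed P X X).
Local Notation Fb := (ftail F).
Local Notation jump := (jump_potential P X Z).

Lemma measurable_jump_at (A : R) n (g : R -> R) : measurable_fun setT g ->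
  measurable_fun setT (fun y => jump (g y) A n 0%R).
Proof.
move=> mg; pose f y z := \int[P]_w
  (if ((g y - Z w < z) && (z <= A))%R then 1 else 0).
have mf : measurable_fun setT (fun p : R * R => f p.1 p.2).
  apply: (@measurable_integral_param _ _ _ P _ (R * R)%type (fun p w =>
    (if ((g p.1 - Z w < p.2) && (p.2 <= A))%R then 1 else 0))).
    by meas.
  by move=> p w; case: ifP.
have f0 y z : 0 <= f y z by apply: integral_ge0 => w _; case: ifP.
have h := measurable_potential_param P mX n mf f0.
have ms : measurable_fun setT (fun y : R => (y, 0%R : R)) by meas.
exact: (measurableT_comp h ms).
Qed.

(* [exceed_le_potential] with the law of the jump above [A] integrated out
   against the bound [k * Fb]. *)
Lemma exceed_le_jump (A h x k : R) (n : nat) :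
  (0 <= A)%R -> (0 <= h)%R -> (A <= x)%R -> (0 <= k)%R ->
  (forall z, (h <= z)%R -> u n z <= (k * Fb z)%:E) ->
  u n.+1 x <= jump (x - h) A n.+1 0 +
    k%:E * \int[F]_y (if ((h < y) && (y <= x - A))%R
      then jump (x - y) A n.+1 0 else 0) +
    (k * Fb (x - A))%:E * u n.+1 A.
Proof.
move=> A0 h0 Ax k0 unk.
have mid : measurable_fun setT (fun y : R => y) by exact: measurable_id.
pose g1 z : \bar R := if (x - h < z)%R then 1 else 0.
pose g2 y z : \bar R :=
  if ((h < y) && (y <= x - A) && (x - y < z))%R then 1 else 0.
(* A jump to [z > x - h] is counted as success. Otherwise [Fb (x - z)] is split at [x - A]: the mass
   of [(x - z, x - A]] goes into [phi], where [h < y] is automatic because [h <= x - z], and the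
   rest is the constant [Fb (x - A)]. *)
pose phi z := g1 z + k%:E * \int[F]_y g2 y z.
have g10 z : 0 <= g1 z by rewrite /g1; case: ifP.
have g20 y z : 0 <= g2 y z by rewrite /g2; case: ifP.
have mg1 : measurable_fun setT g1 by rewrite /g1; meas.
have mg2' : measurable_fun setT (fun p : R * R => g2 p.2 p.1).
  by rewrite /g2; meas.
have ig20 z : 0 <= \int[F]_y g2 y z by apply: integral_ge0.
have mig2 : measurable_fun setT (fun z => \int[F]_y g2 y z).
  exact: (measurable_integral_param F mg2').
have phi0 z : 0 <= phi z by rewrite adde_ge0// mule_ge0// lee_fin.
have mphi : measurable_fun setT phi by rewrite /phi; meas.
have r0 : (0 <= k * Fb (x - A))%R by rewrite mulr_ge0// ftail_ge0.
have := @exceed_le_potential _ _ _ P X Z mX mZ x A _ phi n.+1 XZ mphi phi0 r0 Ax.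
move=> /(_ _ _ n.+1 0%R (leqnn _) A0); rewrite !subr0 => key.
apply: le_trans (key _ _) _.
- move=> j z jn Az zx; rewrite /phi /g1; case: ifPn => hz.
    apply: (le_trans (exceed_le1 P mX mZ j (x - z))).
    by rewrite -addeA leeDl// adde_ge0// ?lee_fin// mule_ge0// lee_fin.
  rewrite -leNgt in hz; rewrite add0e.
  apply: (le_trans (exceed_homo P mX mZ (x - z)%R (ltnSE jn))).
  apply: (le_trans (unk _ _)); first by lra.
  rewrite !EFinM -ge0_muleDr//; last by rewrite lee_fin ftail_ge0.
  apply: lee_wpmul2l; first by rewrite lee_fin.
  rewrite !ftailE !ftail_integral -ge0_integralD//; last 3 first.
  - by rewrite /g2; meas.
  - by move=> y _; case: ifP.
  - by meas.
  apply: le_ge0_integral.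
  - by meas.
  - by rewrite /g2; meas.
  - by move=> y; case: ifP.
  - move=> y; have [xzy|] := ltP (x - z)%R y; last first.
      by move=> _; apply: adde_ge0 => //; case: ifP.
    have [xAy|yxA] := ltP (x - A)%R y; first by rewrite leeDr.
    rewrite adde0 /g2 yxA.
    have -> : (h < y)%R by lra.
    by have -> : (x - y < z)%R by lra.
- move=> z xz; rewrite /phi /g1 ifT; last by lra.
  by rewrite -addeA leeDl// adde_ge0// ?lee_fin// mule_ge0// lee_fin.
apply: leeD => //.
(* Exchanging the integrals over [F] and over the jump turns the potential of [phi] into an average
   of jump potentials at the levels [x - y]. *)
pose f y z := \int[P]_w (if ((x - y - Z w < z) && (z <= A))%R then 1 else 0).
pose G y z := if ((h < y) && (y <= x - A))%R then f y z else 0.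
have f0 y z : 0 <= f y z by apply: integral_ge0 => w _; case: ifP.
have G0 y z : 0 <= G y z by rewrite /G; case: ifP.
have mf : measurable_fun setT (fun p : R * R => f p.1 p.2).
  apply: (@measurable_integral_param _ _ _ P _ (R * R)%type (fun p w =>
    (if ((x - p.1 - Z w < p.2) && (p.2 <= A))%R then 1 else 0))).
    by meas.
  by move=> p w; case: ifP.
have mG : measurable_fun setT (fun p : R * R => G p.1 p.2).
  by rewrite /G; meas.
have mfh : measurable_fun setT (f h).
  exact: (measurable_jump P mZ (x - h) A).
have iG0 z : 0 <= \int[F]_y G y z by apply: integral_ge0.
have mswap : measurable_fun setT (fun p : R * R => G p.2 p.1).
  have ms : measurable_fun setT (fun p : R * R => (p.2, p.1)) by meas.
  exact: (measurableT_comp mG ms).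
have miG : measurable_fun setT (fun z => \int[F]_y G y z).
  exact: (@measurable_integral_param _ _ _ F _ _ (fun z y => G y z) mswap).
apply: (@le_trans _ _ (potential P X
    (fun z => f h z + k%:E * \int[F]_y G y z) n.+1 0%R)).
  apply: le_potential => //.
  - apply: measurable_integral_param; first by meas.
    by move=> y w; case: ifP.
  - by meas.
  - by move=> y; apply: integral_ge0 => w _; case: ifP.
  move=> z; pose q y w : \bar R := if ((h < y) && (y <= x - A) &&
    ((x - y - Z w < z) && (z <= A)))%R then 1 else 0.
  have q0 y w : 0 <= q y w by rewrite /q; case: ifP.
  have mq : measurable_fun setT (fun p : R * T => q p.1 p.2).
    by rewrite /q; meas.
  have mq' : measurable_fun setT (fun p : T * R => q p.2 p.1).
    by rewrite /q; meas.
  have mqw : measurable_fun setT (fun w => \int[F]_y q y w).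
    exact: (@measurable_integral_param _ _ _ F _ _ (fun w y => q y w) mq').
  have iq0 w : 0 <= \int[F]_y q y w by apply: integral_ge0.
  have -> : \int[F]_y G y z = \int[P]_w \int[F]_y q y w.
    rewrite -(@exchange_ge0_integral _ _ _ P _ _ F q)//.
    apply: eq_integral => y _; rewrite /G /f /q; case: ifP => // _.
    by rewrite integral0_eq.
  rewrite /f -ge0_integralZl ?lee_fin// -ge0_integralD//; last 4 first.
  - by move=> w _; case: ifP.
  - by meas.
  - by move=> w _; rewrite mule_ge0// lee_fin.
  - by meas.
  apply: le_ge0_integral.
  - by meas.
  - by meas.
  - by move=> w; case: ifP.
  move=> w; case: ifPn => [/andP[h1 h2]|_]; last first.
    by rewrite adde_ge0// ?mule_ge0// ?lee_fin//; case: ifP.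
  apply: leeD.
    by rewrite /g1 h2 andbT; have -> : (x - h - Z w < z = (x - h < z + Z w))%R by apply/idP/idP; lra.
  apply: lee_wpmul2l => //; apply: le_ge0_integral.
  - by rewrite /g2; meas.
  - by rewrite /q; meas.
  - by move=> y; exact: g20.
  - move=> y; rewrite /g2 /q h2 andbT.
    by have -> : (x - y - Z w < z = (x - y < z + Z w))%R by apply/idP/idP; lra.
rewrite potentialD//; last 2 first.
- by meas.
- by move=> z; rewrite mule_ge0// lee_fin.
rewrite potentialZ// (potential_integral P mX F n.+1 0%R mG G0).
apply: leeD => //; apply: lee_wpmul2l => //.
apply: le_ge0_integral.
- have ms : measurable_fun setT (fun y : R => (y, 0%R : R)) by meas.
  exact: (measurableT_comp (measurable_potential_param P mX n.+1 mG G0) ms).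
- have mxy : measurable_fun setT (fun y : R => x - y)%R by meas.
  by have mj := measurable_jump_at A n.+1 mxy; meas.
- by move=> y; exact: potential_ge0.
- move=> y; rewrite /G; case: ifP => // _.
  by rewrite -/(cst 0) potential0.
Qed.

End upper_bound.

(** With [c = b^-1 + e] the claim is [1 <= c * (1 - r) * a]. As [(1 - r) * a >= b - r * (1 + b)] and
    [c * b = 1 + e * b], it suffices that [r * (1 + b) * c <= e * b]; [r <= b / 2] keeps [a]
    positive. *)
Lemma slope_choice (R : realType) (b e : R) : (0 < b) -> (0 < e) ->
  exists2 r, (0 < r < 1) & forall a q, (b - r < a) -> q = r ->
    (0 < a) /\ (a^-1 / (1 - q) <= b^-1 + e).
Proof.
move=> b0 e0; pose c := (b^-1 + e).
have b'0 : (0 < b^-1) by rewrite invr_gt0.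
have c0 : (0 < c) by rewrite /c; lra.
pose r := Num.min (Num.min (b / 2) (1 / 2)) (e * b / ((1 + b) * c)).
have D0 : (0 < (1 + b) * c) by rewrite mulr_gt0//; lra.
have r0 : (0 < r) by rewrite !lt_min !divr_gt0// ?mulr_gt0//; lra.
have rb : (r <= b / 2) by rewrite /r !ge_min lexx.
have r2 : (r <= 1 / 2) by rewrite /r !ge_min lexx orbT.
have r3 : (r * ((1 + b) * c) <= e * b).
  by rewrite -ler_pdivlMr// /r ge_min lexx orbT.
exists r; first by apply/andP; split => //; lra.
move=> a q ba ->; have a0 : (0 < a) by lra.
split => //; rewrite ler_pdivrMr; last by lra.
rewrite -[leLHS]div1r ler_pdivrMr// -/c.
have bb : b^-1 * b = 1 by rewrite mulVf// lt0r_neq0.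
have cb : c * b = 1 + e * b by rewrite /c mulrDl bb.
have h1 : b - r * (1 + b) <= (1 - r) * a by nra.
have h2 : c * (b - r * (1 + b)) <= c * ((1 - r) * a) by rewrite ler_pM2l.
rewrite -mulrA; apply: le_trans h2; nra.
Qed.

Section upper_asymptotics.
Local Open Scope ereal_scope.
Context d (T : measurableType d) (R : realType) (P : probability T R)
  (X Z : T -> R) (F : probability R R).
Hypotheses (mX : measurable_fun setT X) (mZ : measurable_fun setT Z)
  (iX : P.-integrable setT (EFin \o X)) (iZ : P.-integrable setT (EFin \o Z))
  (XZ : forall w, (X w <= Z w)%R).
Hypotheses (F0 : F `]-oo, 0%R[%classic = 0)
  (Fsub : asymp_equiv (fun x => fine (tail (convolution F F) x))
                      (fun x => 2 * fine (tail F x))%R).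
Local Notation u := (exceed P X Z).
Local Notation v := (exceed P X X).
Local Notation Fb := (ftail F).

(** The bound is needed on all of [[A, oo)], since [x - y] comes down to [A] in the middle part.
    Long-tailedness covers large [s]; on the bounded remainder [Fb] stays above a positive value,
    which only enlarges [C]. *)
Lemma excess_shift_bound (A : R) : (forall x, (0 < Fb x)%R) ->
  (forall y, asymp_equiv (fun x => excess P Z (x + y)%R) Fb) ->
  exists2 C, (0 < C)%R &
    forall s, (A <= s)%R -> (excess P Z (s - A - 1) <= C * Fb s)%R.
Proof.
move=> Fpos ZF.
have [x0 hx0] := (asymp_equivP _ Fpos).1 (ZF (- A - 1)%R) 1%R ltr01.
pose C := (2 + excess P Z (- 1) / Fb x0)%R.
have F0' := Fpos x0; have e0 := excess_ge0 P Z (- 1)%R.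
have q0 : (0 <= excess P Z (- 1) / Fb x0)%R by rewrite divr_ge0// ltW.
exists C => [|s As]; first by rewrite /C; lra.
have Fs := Fpos s.
have [x0s|sx0] := leP x0 s.
  have /andP[_ h] := hx0 _ x0s; rewrite addrA in h.
  apply: (le_trans h); rewrite ler_pM2r// /C; lra.
have h1 : (excess P Z (s - A - 1) <= excess P Z (- 1))%R.
  by apply: excess_nonincr => //; lra.
apply: (le_trans h1); rewrite -[leLHS](divfK (lt0r_neq0 F0')).
apply: ler_pM => //; [exact: ltW|rewrite /C; lra|].
by apply: ftail_nonincr; exact: ltW.
Qed.

(** Three contributions: a jump above [x - h] gives [b^-1]; a moderate jump and a moderate remainder
    form the middle of a convolution; a remainder beyond [x - A] comes with the small probability of
    ever exceeding [A]. Only the last two involve [k]. The threshold [x1] depends neither on [k] nor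
    on [n], so the step can be iterated. *)
Lemma exceed_step (b : R) : (0 < b)%R -> \int[P]_w (X w)%:E = (- b)%:E ->
  (forall e, (0 < e)%R -> exists2 K, (0 <= K)%R & forall n, v n K <= e%:E) ->
  (forall x, (0 < Fb x)%R) ->
  (forall y, asymp_equiv (fun x => Fb (x + y)%R) Fb) ->
  (forall y, asymp_equiv (fun x => excess P Z (x + y)%R) Fb) ->
  forall e, (0 < e)%R -> exists2 h0, (0 <= h0)%R &
  forall h, (h0 <= h)%R -> exists x1, forall k n, (0 <= k)%R ->
  (forall z, (h <= z)%R -> u n z <= (k * Fb z)%:E) ->
  forall x, (x1 <= x)%R -> u n.+1 x <= ((b^-1 + e + e * k) * Fb x)%:E.
Proof.
move=> b0 Xb vsmall Fpos Flong ZF e e0.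
have e2 : (0 < e / 2)%R by lra.
have [r /andP[r0 r1] hr] := slope_choice b0 e2.
have [L [L0 [a ab aE]]] := truncated_drift mX iX r0 Xb.
have [a0 slope] := hr a r ab erefl.
have [K K0 hK] := vsmall _ r0.
have db : drift_bound P X K L r a.
  by split => //; split => //; rewrite (ltW r0) r1.
pose c := (a^-1 / (1 - r))%R.
have c0 : (0 < c)%R by rewrite divr_gt0 ?invr_gt0 ?subr_gt0.
have e4 : (0 < e / 4)%R by lra.
have [A A0 hA] := exceed_small mX mZ iX iZ db vsmall e4.
have [C' C'0 hC'] := excess_shift_bound A Fpos ZF.
pose C := (c * (1 + K + L) * C')%R.
have KL1 : (0 < 1 + K + L)%R by lra.
have C0 : (0 < C)%R by exact: mulr_gt0 (mulr_gt0 c0 KL1) C'0.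
(* [C] compares the jump potential with [Fb], so [convolution_middle_le] with this error yields
   [3 / 8 * e] in the second contribution. *)
have eC : (0 < e / (8 * C))%R by rewrite divr_gt0// mulr_gt0.
have Fcvg : exists h0, (0 <= h0)%R /\ forall h, (h0 <= h)%R -> (Fb h <= e / (8 * C))%R.
  have h12 : (0 < 1 / 2 :> R)%R by lra.
  have [x0 hx0] := (asymp_equivP _ Fpos).1 (ZF 0%R) _ h12.
  have eC2 : (0 < e / (8 * C) / 2)%R by lra.
  have [y0 hy0] := excess_cvg0 mZ iZ eC2.
  exists (Num.max (Num.max x0 y0) 0)%R; split; first by rewrite le_max lexx orbT.
  move=> h; rewrite !ge_max => /andP[/andP[hx hy] _].
  have /andP[+ _] := hx0 h hx; have := hy0 h hy; rewrite addr0; lra.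
have [h0 [h00 hh0]] := Fcvg.
exists h0 => // h hh; have h_ge0 : (0 <= h)%R by lra.
have F2pos x : (0 < 2 * fine (tail F x))%R by rewrite mulr_gt0//; exact: Fpos.
(* The long-tail errors then add up to [e / 4]; with the [e / 2] from the slope this is the
   [3 / 4 * e] of the first contribution. *)
pose e' := (e / (4 * (c * (1 + 2 * (K + L)))))%R.
have KL2 : (0 < 1 + 2 * (K + L))%R by lra.
have cKL : (0 < c * (1 + 2 * (K + L)))%R by exact: mulr_gt0.
have e'0 : (0 < e')%R by rewrite divr_gt0// mulr_gt0.
have [x2 hx2] := (asymp_equivP _ F2pos).1 Fsub _ eC.
have [x3 hx3] := (asymp_equivP _ Fpos).1 (Flong (- A)%R) _ ltr01.
have [x4 hx4] := (asymp_equivP _ Fpos).1 (ZF (- h - A)%R) _ e'0.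
have [x5 hx5] := (asymp_equivP _ Fpos).1 (ZF (- h - A - 1)%R) _ e'0.
exists (Num.max (Num.max x2 x3) (Num.max (Num.max x4 x5) (h + A)))%R.
move=> k n k0 unk x; rewrite !ge_max => /andP[/andP[x2x x3x] /andP[/andP[x4x x5x] xhA]].
have {hx2} /andP[_ hx2] := hx2 _ x2x.
have {hx3} /andP[_ hx3] := hx3 _ x3x.
have {hx4} /andP[hx4' hx4] := hx4 _ x4x.
have {hx5} /andP[_ hx5] := hx5 _ x5x.
have Fx := Fpos x.
have hx : (0 <= h <= x)%R by rewrite h_ge0 (le_trans _ xhA)// lerDl.
have := convolution_middle_le F0 hx A0 (hh0 h hh) hx2.
set mid := (X in X <= _) => hmid2.
have xA : (A <= x)%R by rewrite (le_trans _ xhA)// lerDr.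
apply: (le_trans (exceed_le_jump mX mZ XZ A0 h_ge0 xA k0 unk)).
have T1 : jump_potential P X Z (x - h) A n.+1 0 <= ((b^-1 + 3 / 4 * e) * Fb x)%:E.
  apply: (le_trans (jump_potential_le mX mZ _ _ _ _ db iX iZ)).
  rewrite lee_fin -/c.
  have ce' : (c * (1 + 2 * (K + L)) * e' = e / 4)%R.
    rewrite /e'; field; rewrite !lt0r_neq0//; lra.
  have -> : (x - h - A = x + (- h - A))%R by rewrite addrA.
  have -> : (x + (- h - A) - 1 = x + (- h - A - 1))%R by rewrite !addrA.
  have KL : (0 <= K + L)%R by rewrite addr_ge0.
  set y1 := excess P Z (x + (- h - A)) in hx4 hx4' *.
  set y2 := excess P Z (x + (- h - A - 1)) in hx5 *.
  apply: (@le_trans _ _ (c * ((1 + e') * Fb x + (K + L) * (2 * e' * Fb x))))%R.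
    rewrite ler_pM2l// lerD// ler_wpM2l//; lra.
  have -> : (c * ((1 + e') * Fb x + (K + L) * (2 * e' * Fb x)) =
    (c + c * (1 + 2 * (K + L)) * e') * Fb x)%R by ring.
  by rewrite ce' ler_pM2r//; move: slope; rewrite -/c; lra.
have T2 : \int[F]_y (if ((h < y) && (y <= x - A))%R
    then jump_potential P X Z (x - y) A n.+1 0 else 0) <=
    (3 / 8 * e * Fb x)%:E.
  apply: (@le_trans _ _ (C%:E * mid)); last first.
    apply: (@le_trans _ _ (C%:E * (3 * (e / (8 * C)) * Fb x)%:E)).
      by apply: lee_wpmul2l => //; rewrite lee_fin ltW.
    by rewrite -EFinM lee_fin le_eqVlt; apply/orP; left; apply/eqP; field; rewrite lt0r_neq0.
  have mt : measurable_fun setT (tail F) by exact: measurable_tail.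
  have mid' : measurable_fun setT (fun y : R => y) by exact: measurable_id.
  rewrite /mid -ge0_integralZl ?lee_fin ?(ltW C0)//; last 2 first.
  - by meas.
  - by move=> y _; case: ifP => // _; exact: tail_ge0.
  apply: le_ge0_integral.
  - have mxy : measurable_fun setT (fun y : R => x - y)%R by meas.
    by have mj := measurable_jump_at P mX mZ A n.+1 mxy; meas.
  - by meas.
  - by move=> y; case: ifP => // _; exact: jump_potential_ge0.
  - move=> y; case: ifP => [/andP[hy yx]|_]; last by rewrite mule0.
    apply: (le_trans (jump_potential_le_excess mX mZ iX iZ _ _ _ _ db)).
    rewrite -ftailE -EFinM lee_fin -/c /C -[leRHS]mulrA ler_wpM2l//.
      exact: mulr_ge0 (ltW c0) (ltW KL1).
    by apply: hC'; rewrite lerBrDr addrC -lerBrDr.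
have T3 : (k * Fb (x - A))%:E * u n.+1 A <= (e / 2 * k * Fb x)%:E.
  apply: (@le_trans _ _ ((k * Fb (x - A))%:E * (e / 4)%:E)).
    by apply: lee_wpmul2l => //; rewrite lee_fin mulr_ge0// ftail_ge0.
  rewrite -EFinM lee_fin; have ke : (0 <= k * e)%R by rewrite mulr_ge0// ltW.
  by have := ler_wpM2l ke hx3; lra.
apply: (@le_trans _ _ (((b^-1 + 3 / 4 * e) * Fb x)%:E +
    k%:E * (3 / 8 * e * Fb x)%:E + (e / 2 * k * Fb x)%:E)).
  by apply: leeD => //; apply: leeD => //; apply: lee_wpmul2l.
rewrite -EFinM -!EFinD lee_fin.
have := mulr_ge0 k0 (ltW Fx); have := mulr_gt0 e0 Fx.
have := mulr_ge0 (mulr_ge0 k0 (ltW Fx)) (ltW e0); nra.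
Qed.

(** With [e = 1 / 2] the bound [k * Fb] passes from [n] to [n.+1] as soon as
    [k >= 2 * (b^-1 + 1 / 2)]. Since one [k] serves all [n], a second pass with [e / (1 + k)] gives
    the sharp constant. *)
Lemma exceed_upper (b : R) : (0 < b)%R -> \int[P]_w (X w)%:E = (- b)%:E ->
  (forall e, (0 < e)%R -> exists2 K, (0 <= K)%R & forall n, v n K <= e%:E) ->
  (forall x, (0 < Fb x)%R) ->
  (forall y, asymp_equiv (fun x => Fb (x + y)%R) Fb) ->
  (forall y, asymp_equiv (fun x => excess P Z (x + y)%R) Fb) ->
  forall e, (0 < e)%R -> exists x0, forall x n, (x0 <= x)%R ->
    u n x <= ((b^-1 + e) * Fb x)%:E.
Proof.
move=> b0 Xb vsmall Fpos Flong ZF e e0.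
have b'0 : (0 < b^-1)%R by rewrite invr_gt0.
have step := exceed_step b0 Xb vsmall Fpos Flong ZF.
have h12 : (0 < 1 / 2 :> R)%R by lra.
have [h1 h10 hh1] := step _ h12.
have [x1 hx1] := hh1 h1 (lexx _).
have Fx1 := Fpos x1.
(* The first entry handles the levels between [h1] and [x1], where a probability is just bounded by
   [1]. *)
pose k := Num.max ((Fb x1)^-1)%R (2 * (b^-1 + 1 / 2))%R.
have k1 : ((Fb x1)^-1 <= k)%R by rewrite /k le_max lexx.
have k2 : (2 * (b^-1 + 1 / 2) <= k)%R by rewrite /k le_max lexx orbT.
have k0 : (0 < k)%R by lra.
have bnd n z : (h1 <= z)%R -> u n z <= (k * Fb z)%:E.
  elim: n z => [|n ih] z h1z.
    by rewrite /= lee_fin mulr_ge0 ?ltW//; exact: Fpos.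
  have [x1z|zx1] := leP x1 z.
    apply: (le_trans (hx1 k n (ltW k0) ih z x1z)).
    by rewrite lee_fin ler_pM2r//; lra.
  apply: (le_trans (exceed_le1 P mX mZ _ _)); rewrite lee_fin.
  apply: (@le_trans _ _ (k * Fb x1)%R); first by rewrite -ler_pdivrMr// div1r.
  by rewrite ler_pM2l// ftail_nonincr// ltW.
pose e' := (e / (1 + k))%R.
have e'0 : (0 < e')%R by rewrite divr_gt0//; lra.
have [h2 h20 hh2] := step _ e'0.
have [|x2 hx2] := hh2 (Num.max h2 h1)%R; first by rewrite le_max lexx.
exists x2 => x n x2x; apply: (le_trans (exceed_nondecr P mX mZ n x)).
apply: le_trans (hx2 k n (ltW k0) _ x x2x) _.
  by move=> z; rewrite ge_max => /andP[_ h1z]; exact: bnd.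
rewrite lee_fin ler_pM2r//.
have : (e' * (1 + k) = e)%R by rewrite /e' divfK// lt0r_neq0//; lra.
lra.
Qed.

End upper_asymptotics.

(** * Independent copies *)

(** A pi-system that generates the events determined by the coordinates in [I]. *)
Definition cylinder d d' (T : measurableType d) (U : measurableType d')
    (X : nat -> T -> U) (I : set nat) : set (set T) :=
  [set C | exists (J : {fset nat}) (A : nat -> set U),
    [/\ [set` J] `<=` I, forall k, measurable (A k) &
        C = \bigcap_(k in [set` J]) (X k @^-1` A k)]].

Section independence.
Local Open Scope ereal_scope.
Context d d' (T : measurableType d) (U : measurableType d') (R : realType)
  (P : probability T R) (X : nat -> T -> U).
Hypotheses (mX : forall k, measurable_fun setT (X k))
  (indep : mutually_independent P X).

Let mpre k A : measurable A -> measurable (X k @^-1` A).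
Proof. by move=> mA; rewrite -[X in measurable X]setTI; exact: mX. Qed.

Lemma cylinder_setI_closed I : setI_closed (cylinder X I).
Proof.
move=> _ _ [J [A [JI mA ->]]] [J' [A' [J'I mA' ->]]].
exists (J `|` J')%fset, (fun k => (if k \in J then A k else setT) `&`
  (if k \in J' then A' k else setT)); split.
- by move=> k /=; rewrite in_fsetU => /orP[/JI|/J'I].
- by move=> k; apply: measurableI; case: ifP.
- apply/seteqP; split => w /=.
    move=> [h1 h2] k /=; rewrite in_fsetU => _; split.
      by case: ifPn => // kJ; exact: h1.
    by case: ifPn => // kJ; exact: h2.
  move=> h; split => k /= kJ.
    by have := h k; rewrite /= in_fsetU kJ => /(_ isT) [].
  by have := h k; rewrite /= in_fsetU kJ orbT => /(_ isT) [].
Qed.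

Lemma cylinder_measurable I C : cylinder X I C -> measurable C.
Proof.
move=> [J [A [_ mA ->]]].
by apply: fin_bigcap_measurable => // k _; exact: mpre.
Qed.

Lemma sigma_cylinder_measurable I : <<s cylinder X I >> `<=` measurable.
Proof.
apply: smallest_sub; first exact: sigma_algebra_measurable.
by move=> C; exact: cylinder_measurable.
Qed.

Lemma cylinder_indep I k A C : ~ I k -> measurable A -> cylinder X I C ->
  P (X k @^-1` A `&` C) = P (X k @^-1` A) * P C.
Proof.
move=> Ik mA [J [B [JI mB ->]]].
have kJ : k \notin J by apply/negP => /JI.
pose B' j := if j == k then A else B j.
have mB' j : measurable (B' j) by rewrite /B'; case: ifP.
have h1 := indep (k |` J)%fset mB'.
rewrite big_fsetU1//= /B' eqxx in h1.
have h2 := indep J mB.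
rewrite h2 (_ : X k @^-1` A `&` _ = \bigcap_(j in [set` (k |` J)%fset])
   X j @^-1` (if j == k then A else B j)); last first.
  apply/seteqP; split => w /=.
    move=> [Ak h] j /=; rewrite in_fset1U => /orP[/eqP ->|jJ]; first by rewrite eqxx.
    by case: ifPn => [/eqP ->//|_]; exact: h.
  move=> h; split.
    by have := h k; rewrite /= fset1U1 eqxx; exact.
  move=> j /= jJ; have := h j; rewrite /= in_fset1U jJ orbT => /(_ isT).
  by case: ifPn => // /eqP jk; rewrite -jk jJ in kJ.
rewrite h1; congr (_ * _); rewrite big_seq [RHS]big_seq.
apply: eq_bigr => j jJ; case: ifPn => // /eqP jk.
by rewrite -jk jJ in kJ.
Qed.

(** Dynkin's argument: the events independent of [B] form a lambda-system, and it contains the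
    cylinders. *)
Lemma sigma_cylinder_indep I k A E : ~ I k -> measurable A ->
  <<s cylinder X I >> E -> P (X k @^-1` A `&` E) = P (X k @^-1` A) * P E.
Proof.
move=> Ik mA; pose B := X k @^-1` A.
have mB : measurable B by exact: mpre.
pose H := [set E | measurable E /\ P (B `&` E) = P B * P E].
suff : <<s cylinder X I >> `<=` H by move=> + sE => /(_ E sE)[].
apply: lambda_system_subset => //; first exact: cylinder_setI_closed.
- split => //.
  + by split => //; rewrite setIT [X in _ * X]probability_setT mule1.
  + move=> C D DC [mC hC] [mD hD]; split; first exact: measurableD.
    have Cf : P C < +oo by rewrite -ge0_fin_numE// fin_num_measure.
    have BCf : P (B `&` C) < +oo.
      by rewrite -ge0_fin_numE// fin_num_measure//; exact: measurableI.
    rewrite setIDA measureD//; [|exact: measurableI].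
    have -> : B `&` C `&` D = B `&` D by rewrite -setIA; congr (_ `&` _); exact/setIidPr.
    rewrite measureD// (setIidr DC) muleBr ?fin_num_measure//.
      by rewrite -hC -hD.
    by rewrite fin_num_adde_defr// fin_num_measure.
  + move=> G ndG hG; have mG i : measurable (G i) by have [] := hG i.
    have mUG : measurable (\bigcup_i G i) by exact: bigcup_measurable.
    split => //.
    have h1 := nondecreasing_cvg_mu mG mUG ndG (mu := P).
    have mBG i : measurable (B `&` G i) by exact: measurableI.
    have h2 : P (B `&` G i) @[i --> \oo] --> P (B `&` \bigcup_i G i).
      rewrite setI_bigcupr; apply: (nondecreasing_cvg_mu mBG).
        by rewrite -setI_bigcupr; exact: measurableI.
      by move=> m n mn; rewrite subsetEset; apply: setIS; rewrite -subsetEset; exact: ndG.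
    have h3 : P B * P (G i) @[i --> \oo] --> P B * P (\bigcup_i G i).
      by apply: cvgeZl h1; rewrite fin_num_measure.
    apply: (cvg_unique _ h2); first exact: ereal_hausdorff.
    apply: cvg_trans h3; apply: near_eq_cvg; near=> i.
    by have [] := hG i.
- by move=> C sC; split; [exact: cylinder_measurable sC|exact: cylinder_indep sC].
Unshelve. all: by end_near. Qed.

End independence.

Section joint_law.
Local Open Scope ereal_scope.
Context d0 d d' (T0 : measurableType d0) (T : measurableType d)
  (U : measurableType d') (R : realType)
  (P0 : probability T0 R) (P : probability T R)
  (X0 : T0 -> U) (X : nat -> T -> U).
Hypotheses (mX0 : measurable_fun setT X0) (mX : forall k, measurable_fun setT (X k))
  (copies : independent_copies P0 X0 P X).

Lemma measurable_cylinder_coord (I : set nat) k : I k ->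
  measurable_fun setT (X k : g_sigma_algebraType (cylinder X I) -> U).
Proof.
move=> Ik _ A mA; rewrite setTI; apply: sub_sigma_algebra.
exists [fset k]%fset, (fun=> A); split => //.
  by move=> j /=; rewrite inE => /eqP ->.
apply/seteqP; split => w /=; first by move=> Aw j /=; rewrite inE => /eqP ->.
by move=> /(_ k); apply; rewrite /= inE.
Qed.

(** The second factor is [T] itself with the sigma-algebra of the coordinates in [I], so no sequence
    space is built. Independence makes the law of [(X k w, w)] a product measure, and [X k] can be
    frozen. *)
Lemma joint_law (I : set nat) k
    (C : set (U * g_sigma_algebraType (cylinder X I))) : ~ I k ->
  measurable C ->
  P [set w | C (X k w, w)] = \int[P0]_t P [set w | C (X0 t, w)].
Proof.
move=> Ik mC.
pose T' := g_sigma_algebraType (cylinder X I).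
have mid : measurable_fun setT (fun w : T => w : T').
  by move=> _ A mA; rewrite setTI; exact: (sigma_cylinder_measurable mX mA).
have mpair : measurable_fun setT (fun w : T => (X k w, w : T')).
  by apply: measurable_fun_pair.
pose Y0 : {mfun T0 >-> U} := HB.pack X0 (isMeasurableFun.Build _ _ _ _ X0 mX0).
pose Y1 : {mfun T >-> T'} :=
  HB.pack (fun w : T => w : T') (isMeasurableFun.Build _ _ _ _ _ mid).
pose Y2 : {mfun T >-> (U * T')%type} :=
  HB.pack (fun w : T => (X k w, w : T')) (isMeasurableFun.Build _ _ _ _ _ mpair).
have h := @product_measure_unique _ _ _ _ R (distribution P0 Y0)
  (distribution P Y1) (distribution P Y2).
rewrite -[LHS]/(distribution P Y2 C) -h//; last first.
  move=> A B mA mB.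
  change (P (X k @^-1` A `&` B) = P0 (X0 @^-1` A) * P B).
  by rewrite (sigma_cylinder_indep mX copies.2 Ik mA mB) (copies.1 k A mA).
rewrite /product_measure1 ge0_integral_distribution//; last first.
  exact: measurable_fun_xsection.
apply: eq_integral => t _ /=; rewrite /distribution /pushforward.
by congr (P _); apply/seteqP; split => w; rewrite /xsection/= inE.
Qed.

End joint_law.

Section crossing.
Local Open Scope ereal_scope.
Context d0 d d' (T0 : measurableType d0) (T : measurableType d)
  (U : measurableType d') (R : realType)
  (P0 : probability T0 R) (P : probability T R)
  (X0 : T0 -> U).
Hypotheses (mX0 : measurable_fun setT X0).

Definition crossing (f g : U -> R) (X : nat -> T -> U) n (x : R) : set T :=
  [set w | exists2 k, (k < n)%N &
    (x < walk (fun j w => f (X j w)) k w + g (X k w))%R].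

Lemma independent_copies_shift (X : nat -> T -> U) :
  independent_copies P0 X0 P X ->
  independent_copies P0 X0 P (fun k => X k.+1).
Proof.
move=> [law indep]; split=> [k|I A mA]; first exact: law.
have h := indep (S @` I)%fset (fun k => A k.-1) (fun k => mA _).
rewrite big_imfset/= in h; last by move=> i j _ _ [].
rewrite -h; congr (P _); apply/seteqP; split => w /= hw k /=.
  by move=> /imfsetP[j /= jI ->]; exact: hw.
by move=> kI; apply: (hw k.+1); rewrite /= mem_imfset// => i j [].
Qed.

(** Only the first [n] steps have to be measurable, so the lemma also applies to [T] with the
    sigma-algebra of these coordinates alone. *)
Lemma measurable_walk dT (T' : measurableType dT) (x : nat -> T' -> R) n :
  (forall k, (k < n)%N -> measurable_fun setT (x k)) ->
  measurable_fun setT (walk x n).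
Proof.
move=> mx; rewrite /walk.
rewrite (_ : (fun w => _) = (fun w => \sum_(k <- index_enum 'I_n) x k w)%R)//.
by apply: measurable_sum => k; apply: mx.
Qed.

Lemma walkS (S : Type) (x : nat -> S -> R) n w :
  walk x n.+1 w = (x 0%N w + walk (fun k => x k.+1) n w)%R.
Proof. by rewrite /walk big_ord_recl. Qed.

Context (f g : U -> R).
Hypotheses (mf : measurable_fun setT f) (mg : measurable_fun setT g).

Lemma measurable_crossing X n x : (forall k, measurable_fun setT (X k)) ->
  measurable (crossing f g X n x).
Proof.
move=> mX; rewrite (_ : crossing f g X n x = \bigcup_(k in `I_n)
    [set w | (x < walk (fun j w => f (X j w)) k w + g (X k w))%R]); last first.
  by apply/seteqP; split => w [k kn h]; exists k.
apply: bigcup_measurable => k _.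
have mw : measurable_fun setT (walk (fun j w => f (X j w)) k).
  by apply: measurable_walk => j _; meas.
have mxk := mX k.
rewrite -[X in measurable X]setTI.
have : measurable_fun setT (fun w => x < walk (fun j w => f (X j w)) k w + g (X k w))%R.
  by meas.
by move=> h; exact: (h _ [set true]).
Qed.

(** Freezing the first copy reproduces the recursion of [exceed], as the shifted sequence again
    consists of independent copies. *)
Lemma crossing_exceed X n x : (forall k, measurable_fun setT (X k)) ->
  independent_copies P0 X0 P X ->
  P (crossing f g X n x) = exceed P0 (f \o X0) (g \o X0) n x.
Proof.
elim: n X x => [|n ih] X x mX copies.
  by rewrite (_ : crossing _ _ _ _ _ = set0) ?measure0//; apply/seteqP; split => w [].
pose I : set nat := [set k | (0 < k)%N].
pose T' := g_sigma_algebraType (cylinder X I).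
pose Y : nat -> T -> U := fun k => X k.+1.
have mY k : measurable_fun setT (Y k : T' -> U) by exact: measurable_cylinder_coord.
pose W k : T' -> R := walk (fun j w => f (Y j w)) k.
have mW k : measurable_fun setT (W k).
  by apply: measurable_walk => j _; have := mY j; move=> ?; meas.
pose C := [set q : U * T' | (x < g q.1)%R] `|` \bigcup_(k in `I_n)
  [set q : U * T' | (x - f q.1 < W k q.2 + g (Y k q.2))%R].
have mC : measurable C.
  apply: measurableU; last apply: bigcup_measurable => k _.
    have h : measurable_fun setT (fun q : U * T' => x < g q.1)%R by meas.
    exact: measurable_bool_set h.
  have mYk := mY k; have mWk := mW k.
  have h : measurable_fun setT
    (fun q : U * T' => x - f q.1 < W k q.2 + g (Y k q.2))%R by meas.
  exact: measurable_bool_set h.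
have -> : crossing f g X n.+1 x = [set w | C (X 0%N w, w)].
  apply/seteqP; split => w /=.
    move=> [[_|k]]; first by rewrite /walk big_ord0 add0r; left.
    by rewrite ltnS walkS -addrA -ltrBlDl => kn h; right; exists k.
  move=> [h|[k /= kn h]]; first by exists 0%N => //; rewrite /walk big_ord0 add0r.
  by exists k.+1 => //; rewrite walkS -addrA -ltrBlDl.
have I0 : ~ I 0%N by [].
rewrite (joint_law mX0 mX copies I0 mC) exceedS; apply: eq_integral => t _ /=.
case: ifPn => xg.
  rewrite (_ : [set w | _] = setT) ?probability_setT//.
  by apply/seteqP; split => // w _; left.
rewrite -(ih Y)//; last 2 first.
- by move=> k; exact: mX.
- exact: independent_copies_shift.
congr (P _); apply/seteqP; split => w /=.
  by move=> [/= h|[k /= kn h]]; [rewrite h in xg|exists k].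
by move=> [k kn h]; right; exists k.
Qed.

End crossing.

(** * The maximal ergodic inequality *)

Section maximal_inequality.
Local Open Scope ereal_scope.
Context d0 d d' (T0 : measurableType d0) (T : measurableType d)
  (U : measurableType d') (R : realType)
  (P0 : probability T0 R) (P : probability T R)
  (X0 : T0 -> U).
Hypotheses (mX0 : measurable_fun setT X0).
Context (f : U -> R).
Hypotheses (mf : measurable_fun setT f).
Implicit Type X : nat -> T -> U.

Lemma same_law_integral X k (h : U -> \bar R) : measurable_fun setT h ->
  (forall p, 0 <= h p) -> measurable_fun setT (X k) ->
  same_law P0 X0 P (X k) -> \int[P]_w h (X k w) = \int[P0]_t h (X0 t).
Proof.
move=> mh h0 mXk law.
rewrite -[LHS](@ge0_integral_pushforward _ _ _ _ _ _ mXk P setT h)//.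
rewrite -[RHS](@ge0_integral_pushforward _ _ _ _ _ _ mX0 P0 setT h)//.
apply: eq_measure_integral => A mA _; exact: law.
Qed.

Lemma same_law_integrable X k : measurable_fun setT (X k) ->
  same_law P0 X0 P (X k) -> P0.-integrable setT (EFin \o (f \o X0)) ->
  P.-integrable setT (EFin \o (fun w => f (X k w))).
Proof.
move=> mXk law /integrableP[m1 h1]; apply/integrableP; split.
  by rewrite /comp; meas.
move: h1; rewrite -(@same_law_integral X k (fun p => `|(f p)%:E|))//.
by apply: measurableT_comp => //; meas.
Qed.

Lemma same_law_mean X k (b : R) : measurable_fun setT (X k) ->
  same_law P0 X0 P (X k) -> P0.-integrable setT (EFin \o (f \o X0)) ->
  \int[P0]_t (f (X0 t))%:E = b%:E -> \int[P]_w (f (X k w))%:E = b%:E.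
Proof.
move=> mXk law ifX <-.
have ifk := same_law_integrable mXk law ifX.
have mE : measurable_fun setT (fun p => (f p)%:E) by meas.
rewrite -[LHS](@integral_pushforward _ _ _ _ _ _ mXk P setT _ mE ifk)//.
rewrite -[RHS](@integral_pushforward _ _ _ _ _ _ mX0 P0 setT _ mE ifX)//.
by apply: eq_measure_integral => A mA _; exact: law.
Qed.

(** The maximum of [0] and the first [n] partial sums, in Lindley's form, which exhibits the first
    step and the shifted walk. *)
Fixpoint pos_max n X (w : T) : R :=
  if n is m.+1 then Num.max 0%R (f (X 0%N w) + pos_max m (fun k => X k.+1) w)%R
  else 0%R.

Lemma pos_max_ge0 n X w : (0 <= pos_max n X w)%R.
Proof. by case: n => [|n]/=; rewrite ?le_max lexx. Qed.

Lemma measurable_pos_max n X : (forall k, measurable_fun setT (X k)) ->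
  measurable_fun setT (pos_max n X).
Proof.
elim: n X => [|n ih] X mX /=; first exact: measurable_cst.
have h1 := mX 0%N; have h2 := ih _ (fun k => mX k.+1).
by meas.
Qed.

Lemma pos_maxS n X w : pos_max n.+1 X w =
  Num.max 0%R (f (X 0%N w) + pos_max n (fun k => X k.+1) w)%R.
Proof. by []. Qed.

Lemma pos_max_homo n X w : (pos_max n X w <= pos_max n.+1 X w)%R.
Proof.
elim: n X => [|n ih] X; first exact: pos_max_ge0.
rewrite (pos_maxS n.+1) (pos_maxS n).
by rewrite ge_max !le_max lexx/= lerD2l ih orbT.
Qed.

Lemma pos_max_crossing n X (x : R) : (0 <= x)%R ->
  [set w | (x < pos_max n X w)%R] = crossing f f X n x.
Proof.
elim: n X x => [|n ih] X x x0.
  by apply/seteqP; split => w /= => [|[]//]; rewrite ltNge x0.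
apply/seteqP; split => w /=.
  rewrite lt_max (ltNge x 0)%R x0/= => h.
  have [xf|fx] := ltP x (f (X 0%N w)).
    by exists 0%N => //; rewrite /walk big_ord0 add0r.
  have xf0 : (0 <= x - f (X 0%N w))%R by rewrite subr_ge0.
  have : crossing f f (fun k => X k.+1) n (x - f (X 0%N w)) w.
    by rewrite -ih//= ltrBlDl.
  by move=> [k kn hk]; exists k.+1 => //; rewrite walkS -addrA -ltrBlDl.
move=> [k kn hk]; rewrite lt_max; apply/orP; right.
case: k kn hk => [_|k]; first by rewrite /walk big_ord0 add0r => h;
  rewrite (lt_le_trans h)// lerDl pos_max_ge0.
rewrite ltnS walkS -addrA -ltrBlDl => kn hk.
have [xf|fx] := ltP x (f (X 0%N w)).
  by rewrite (lt_le_trans xf)// lerDl pos_max_ge0.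
have xf0 : (0 <= x - f (X 0%N w))%R by rewrite subr_ge0.
rewrite -ltrBlDl.
have : crossing f f (fun k => X k.+1) n (x - f (X 0%N w)) w by exists k.
by rewrite -ih.
Qed.

(** The right side involves only the law of one copy; hence shifting the sequence does not change
    the mean. *)
Lemma integral_pos_max n X : (forall k, measurable_fun setT (X k)) ->
  independent_copies P0 X0 P X ->
  \int[P]_w (pos_max n X w)%:E = \int[lebesgue_measure]_(r in `[0%R, +oo[)
    exceed P0 (f \o X0) (f \o X0) n r.
Proof.
move=> mX copies; have mp := measurable_pos_max n mX.
pose Y : {mfun T >-> R} := HB.pack (pos_max n X)
  (isMeasurableFun.Build _ _ _ _ (pos_max n X) mp).
have Y0 w : (0 <= Y w)%R by exact: pos_max_ge0.
have := @ge0_expectation_ccdf _ _ _ P Y Y0.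
rewrite expectation_def => ->; apply: eq_integral => r.
rewrite inE/= in_itv/= andbT => r0.
rewrite -(crossing_exceed mX0 mf mf n r mX copies) -pos_max_crossing//.
by congr (P _); apply/seteqP; split => w /=; rewrite in_itv/= andbT.
Qed.

Lemma integrable_pos_max n X : (forall k, measurable_fun setT (X k)) ->
  (forall k, P.-integrable setT (EFin \o (fun w => f (X k w)))) ->
  P.-integrable setT (EFin \o pos_max n X).
Proof.
elim: n X => [|n ih] X mX iX /=.
  by rewrite (_ : _ \o _ = cst 0)//; exact: integrable0.
have mX0' := mX 0%N.
have h := ih _ (fun k => mX k.+1) (fun k => iX k.+1).
have hmp := measurable_pos_max n (fun k => mX k.+1).
have ms : measurable_fun setT
   (fun w => f (X 0%N w) + pos_max n (fun k => X k.+1) w)%R by meas.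
have := @integrable_maxr_cst _ _ _ P _ ms 0%R.
rewrite (_ : (fun w => Num.max _ 0%R) = pos_max n.+1 X).
  by apply; exact: (integrableD measurableT (iX 0%N) h).
by apply/funext => w /=; rewrite maxC.
Qed.

(* The maximal ergodic inequality: on the event that the positive maximum of
   the first [n.+1] sums is positive, it is the first step plus the positive
   maximum of the shifted walk, which has the same law. *)
Lemma exceed_self_lt1 X (b : R) : (forall k, measurable_fun setT (X k)) ->
  independent_copies P0 X0 P X ->
  P0.-integrable setT (EFin \o (f \o X0)) -> (0 < b)%R ->
  \int[P0]_t (f (X0 t))%:E = (- b)%:E ->
  exists2 p : R, (0 <= p < 1)%R &
    forall n, exceed P0 (f \o X0) (f \o X0) n 0%R <= p%:E.
Proof.
move=> mX copies ifX b0 fb.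
have ifk k := same_law_integrable (mX k) (copies.1 k) ifX.
have fb0 := same_law_mean (mX 0%N) (copies.1 0%N) ifX fb.
have mX0' := mX 0%N.
pose N w := (- f (X 0%N w))%R.
have mN : measurable_fun setT N by rewrite /N; meas.
have iN : P.-integrable setT (EFin \o N).
  by rewrite (_ : EFin \o N = -%E \o (EFin \o (fun w => f (X 0%N w))))//; exact: integrableN.
have b2 : (0 < b / 2)%R by lra.
have [L0 hL0] := excess_cvg0 mN iN b2.
(* [L0] brings the mean excess of [N] over [L] below [b / 2], half of the drift; [b] makes [L]
   positive and keeps [1 - b / (2 * L)] nonnegative. *)
pose L := Num.max L0 b.
have L0L : (L0 <= L)%R by rewrite /L le_max lexx.
have bL : (b <= L)%R by rewrite /L le_max lexx orbT.
have hL := hL0 _ L0L.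
have Lpos : (0 < L)%R by lra.
have bL1 : (b / (2 * L) <= 1)%R by rewrite ler_pdivrMr ?mulr_gt0//; lra.
have bL0 : (0 < b / (2 * L))%R by rewrite divr_gt0// mulr_gt0.
exists (1 - b / (2 * L))%R => [|n]; first by apply/andP; split; lra.
apply: (le_trans (exceed_nondecr _ _ _ _ _)).
  by apply: measurableT_comp.
  by apply: measurableT_comp.
rewrite -(crossing_exceed mX0 mf mf n.+1 0%R mX copies) -pos_max_crossing//.
pose Y k := X k.+1.
have mY k : measurable_fun setT (Y k) by exact: mX.
have iYk k : P.-integrable setT (EFin \o (fun w => f (Y k w))) by exact: ifk.
have mm := measurable_pos_max n mX.
have mmS := measurable_pos_max n.+1 mX.
have mmY := measurable_pos_max n mY.
have im := integrable_pos_max n mX ifk.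
have imY := integrable_pos_max n mY iYk.
have eqm : \int[P]_w (pos_max n X w)%:E = \int[P]_w (pos_max n Y w)%:E.
  rewrite !integral_pos_max//; exact: independent_copies_shift.
pose A := [set w | (0 < pos_max n.+1 X w)%R].
have mA : measurable A.
  have h : measurable_fun setT (fun w => 0 < pos_max n.+1 X w)%R by meas.
  exact: measurable_bool_set h.
have PA : P A \is a fin_num by rewrite fin_num_measure.
(* Off [A] the maximum vanishes, and [L] plus the excess of [N] over [L] offsets a negative first
   step. After integration the means of the two maxima cancel, so [L] times the probability of the
   complement of [A] is at least [b / 2]. *)
have key : \int[P]_w (pos_max n X w)%:E <= \int[P]_w
  ((f (X 0%N w))%:E + (L * \1_(~` A) w)%:E + (Num.max (N w - L) 0)%:E +
   (pos_max n Y w)%:E).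
  apply: le_ge0_integral.
  - by meas.
  - have mI : measurable_fun setT (\1_(~` A) : T -> R).
      exact/measurable_indic/measurableC.
    by meas.
  - by move=> w; rewrite lee_fin pos_max_ge0.
  - move=> w; rewrite -!EFinD lee_fin indicE in_setC.
    have p0 := pos_max_ge0 n Y w; have m0 : (0 <= Num.max (N w - L) 0)%R.
      by rewrite le_max lexx orbT.
    have m1 : (N w - L <= Num.max (N w - L) 0)%R by rewrite le_max lexx.
    have := pos_max_homo n X w; rewrite pos_maxS -/Y => h.
    have [wA|wA] := boolP (w \in A).
      have : A w by rewrite inE in wA.
      rewrite /A/= lt_max ltxx/= -/Y => fpos.
      rewrite mulr0 addr0; apply: (le_trans h); rewrite ge_max; apply/andP; split; lra.
    have : ~ A w by move: wA; rewrite notin_setE.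
    rewrite /A/= lt_max ltxx/= -/Y => /negP; rewrite -leNgt => fneg.
    move: h; rewrite (max_idPl fneg)/= mulr1 /N in m1 *; lra.
have mI : measurable_fun setT (\1_(~` A) : T -> R).
  exact/measurable_indic/measurableC.
have i1 := ifk 0%N.
have i2 : P.-integrable setT (EFin \o (fun w => L * \1_(~` A) w)%R).
  rewrite (_ : EFin \o _ = (fun w => L%:E * (\1_(~` A) w)%:E)).
    by apply: integrableZl => //; apply: integrable_indic; exact: measurableC.
  by apply/funext.
have i3 := integrable_excess mN iN L.
have i12 := integrableD measurableT i1 i2.
have i123 := integrableD measurableT i12 i3.
have E2 : \int[P]_w (L * \1_(~` A) w)%:E = L%:E * P (~` A).
  under eq_integral do rewrite EFinM.
  rewrite ge0_integralZl ?lee_fin ?(ltW Lpos)//; last by meas.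
  by rewrite integral_indic ?setIT//; exact: measurableC.
move: key.
rewrite (integralD measurableT i123 imY) (integralD measurableT i12 i3).
rewrite (integralD measurableT i1 i2) fb0 E2 -(excessE mN iN) -eqm.
have mfin : \int[P]_w (pos_max n X w)%:E \is a fin_num.
  exact: (integrable_fin_num measurableT im).
rewrite probability_setC// -/A -(fineK PA) -(fineK mfin) -EFinB -EFinM -!EFinD lee_fin => hA.
rewrite lee_fin; have : (b / (2 * L) * L = b / 2)%R by field; rewrite lt0r_neq0.
nra.
Qed.

End maximal_inequality.

(** * Lower bound: one big jump *)

Section lower_bound.
Local Open Scope ereal_scope.
Context d0 d d' (T0 : measurableType d0) (T : measurableType d)
  (U : measurableType d') (R : realType)
  (P0 : probability T0 R) (P : probability T R)
  (X0 : T0 -> U) (X : nat -> T -> U) (f g : U -> R).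
Hypotheses (mX0 : measurable_fun setT X0)
  (mX : forall k, measurable_fun setT (X k))
  (copies : independent_copies P0 X0 P X)
  (mf : measurable_fun setT f) (mg : measurable_fun setT g)
  (ifX : P0.-integrable setT (EFin \o (f \o X0)))
  (igX : P0.-integrable setT (EFin \o (g \o X0))).
Local Notation S := (walk (fun j w => f (X j w))).
Local Notation Hbar t := (P0 [set s | (t < g (X0 s))%R]).
Local Notation exc := (excess P0 (g \o X0)).

(** [G] concerns the copy after the jump, which is independent of the jump and of the past; it will
    bound the next term of the series from below. The second condition makes the perturbation itself
    large, not only the level attained. *)
Definition big_jump (G : set U) (y : R) : set T :=
  [set w | exists k, [/\ (y < S k w + g (X k w))%R, (y < g (X k w))%R &
                        G (X k.+1 w)]].

Lemma measurable_big_jump G y : measurable G -> measurable (big_jump G y).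
Proof.
move=> mG; rewrite (_ : big_jump G y = \bigcup_k
  ([set w | ((y < S k w + g (X k w)) && (y < g (X k w)))%R] `&` X k.+1 @^-1` G)).
  apply: bigcup_measurable => k _; apply: measurableI.
    have mS : measurable_fun setT (S k) by apply: measurable_walk => j _; meas.
    have mXk := mX k.
    have h : measurable_fun setT
      (fun w => (y < S k w + g (X k w)) && (y < g (X k w)))%R by meas.
    exact: measurable_bool_set h.
  by rewrite -[X in measurable X]setTI; exact: mX.
apply/seteqP; split => w /=.
  by move=> [k [h1 h2 h3]]; exists k => //; split => //=; rewrite h1 h2.
by move=> [k _ [/= /andP[h1 h2] h3]]; exists k.
Qed.

Let tail_law k t : P [set w | (t < g (X k w))%R] = Hbar t.
Proof.
have mA : measurable [set p | (t < g p)%R].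
  have h : measurable_fun setT (fun p => t < g p)%R by meas.
  exact: measurable_bool_set h.
exact: (copies.1 k _ mA).
Qed.

(** Telescoping of [tail_step]: each term is compared with the interval to its left, whence the
    start at [x - b]. *)
Lemma sum_tail_le (x b : R) n : (0 <= b)%R ->
  b%:E * \sum_(j < n) Hbar (x + b * j%:R)%R <= (exc (x - b))%:E.
Proof.
move=> b0.
have mgX : measurable_fun setT (g \o X0) by exact: measurableT_comp.
suff : b%:E * \sum_(j < n) Hbar (x + b * j%:R)%R + (exc (x - b + b * n%:R)%R)%:E
   <= (exc (x - b))%:E.
  by apply: le_trans; rewrite leeDl// lee_fin excess_ge0.
elim: n => [|n ih]; first by rewrite big_ord0 mule0 add0e mulr0 addr0.
apply: le_trans ih; rewrite big_ord_recr/= ge0_muleDr//; last first.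
  by apply: sume_ge0.
rewrite -addeA; apply: leeD => //.
have := tail_step mgX igX (x - b + b * n%:R)%R b0.
rewrite (_ : x - b + b * n%:R + b = x + b * n%:R)%R; last by ring.
by rewrite (_ : x - b + b * n.+1%:R = x + b * n%:R)%R// -natr1; ring.
Qed.

Lemma sum_tail_ge (x b : R) n : (0 <= b)%R ->
  (exc x)%:E <= b%:E * \sum_(j < n) Hbar (x + b * j%:R)%R +
    (exc (x + b * n%:R)%R)%:E.
Proof.
move=> b0.
have mgX : measurable_fun setT (g \o X0) by exact: measurableT_comp.
elim: n => [|n ih]; first by rewrite big_ord0 mule0 add0e mulr0 addr0.
apply: (le_trans ih); rewrite big_ord_recr/= ge0_muleDr//; last first.
  by apply: sume_ge0.
rewrite -addeA; apply: leeD => //.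
have := excess_step mgX igX (x + b * n%:R)%R b0.
by rewrite (_ : x + b * n%:R + b = x + b * n.+1%:R)%R// -natr1; ring.
Qed.

(* The events [A k], on which the first big jump is the [k]-th one, are
   disjoint, and the three parts of each of them are independent. *)
Lemma big_jump_sum_ge (G : set U) (r b C y : R) n : measurable G ->
  (0 <= r <= 1 / 2)%R -> (0 < b)%R -> (0 <= C)%R -> (0 <= y)%R ->
  (1 - r)%:E <= P0 (X0 @^-1` G) ->
  (forall k, P [set w | (S k w < - (b * k%:R) - C)%R] <= r%:E) ->
  (exc (y + C - b) <= b * r)%R ->
  ((1 - r) * (1 - 2 * r))%:E * \sum_(k < n) Hbar (y + C + b * k%:R)%R <=
  P (big_jump G y).
Proof.
move=> mG /andP[r0 r2] b0 C0 y0 hG hS hr.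
(* The threshold rises as fast as the lower line for [S k] falls, so a jump above [t k] brings the
   walk above [y]. *)
pose t k := (y + C + b * k%:R)%R.
pose past k := [set w | (- (b * k%:R) - C <= S k w)%R] `&`
  \bigcap_(j in `I_k) [set w | (g (X j w) <= t j)%R].
pose A k := past k `&` [set w | (t k < g (X k w))%R] `&` X k.+1 @^-1` G.
have past_sigma k : <<s cylinder X `I_k >> (past k).
  pose T' := g_sigma_algebraType (cylinder X `I_k).
  have mXj j : (j < k)%N -> measurable_fun setT (X j : T' -> U).
    by move=> jk; exact: measurable_cylinder_coord.
  have mS : measurable_fun setT (S k : T' -> R).
    by apply: measurable_walk => j jk; have ? := mXj j jk; meas.
  change (measurable (past k : set T')); apply: measurableI.
    have h : measurable_fun setT (fun w : T' => - (b * k%:R) - C <= S k w)%R by meas.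
    exact: measurable_bool_set h.
  apply: fin_bigcap_measurable => // j jk; have ? := mXj j jk.
  have h : measurable_fun setT (fun w : T' => g (X j w) <= t j)%R by meas.
  exact: measurable_bool_set h.
have mpast k : measurable (past k) by exact: (sigma_cylinder_measurable mX (past_sigma k)).
have mtail k : measurable [set w | (t k < g (X k w))%R].
  have ? := mX k; have h : measurable_fun setT (fun w => t k < g (X k w))%R by meas.
  exact: measurable_bool_set h.
have mA k : measurable (A k).
  apply: measurableI; first exact: measurableI.
  by rewrite -[X in measurable X]setTI; exact: mX.
have past_tail_sigma k :
    <<s cylinder X `I_k.+1 >> (past k `&` [set w | (t k < g (X k w))%R]).
  pose T' := g_sigma_algebraType (cylinder X `I_k.+1).
  have mXk : measurable_fun setT (X k : T' -> U).
    by apply: measurable_cylinder_coord; exact: ltnSn.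
  change (measurable (past k `&` [set w | (t k < g (X k w))%R] : set T')).
  apply: measurableI; last first.
    have h : measurable_fun setT (fun w : T' => t k < g (X k w))%R by meas.
    exact: measurable_bool_set h.
  have : <<s cylinder X `I_k >> `<=` <<s cylinder X `I_k.+1 >>.
    apply: sub_sigma_algebra2 => C' [J [B [JI mB ->]]]; exists J, B; split => //.
    by move=> j /JI /=; exact: leqW.
  by apply; exact: past_sigma.
have PA k : P (A k) = P0 (X0 @^-1` G) * (Hbar (t k) * P (past k)).
  have nk : ~ `I_k.+1 k.+1 by rewrite /= ltnn.
  have nk' : ~ `I_k k by rewrite /= ltnn.
  rewrite /A setIC (sigma_cylinder_indep mX copies.2 nk mG (past_tail_sigma k)).
  rewrite (copies.1 k.+1 G mG); congr (_ * _); rewrite setIC.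
  have mB : measurable [set p | (t k < g p)%R].
    have h : measurable_fun setT (fun p => t k < g p)%R by meas.
    exact: measurable_bool_set h.
  have := sigma_cylinder_indep mX copies.2 nk' mB (past_sigma k).
  by rewrite -[X k @^-1` _]/[set w | (t k < g (X k w))%R] tail_law.
(* One [r] is for a walk below its line, the other for an earlier jump, by the union bound and
   [sum_tail_le]. *)
have Ppast k : (1 - 2 * r)%:E <= P (past k).
  have mSk : measurable [set w | (S k w < - (b * k%:R) - C)%R].
    have mS : measurable_fun setT (S k) by apply: measurable_walk => j _; meas.
    have h : measurable_fun setT (fun w => S k w < - (b * k%:R) - C)%R by meas.
    exact: measurable_bool_set h.
  rewrite -[past k]setCK probability_setC; last exact: measurableC.
  have : P (~` past k) <= (2 * r)%:E.
    apply: (@le_trans _ _ (P ([set w | (S k w < - (b * k%:R) - C)%R] `|`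
        \big[setU/set0]_(j < k) [set w | (t j < g (X j w))%R]))).
      apply: le_measure; rewrite ?inE; first exact: measurableC.
        by apply: measurableU => //; exact: bigsetU_measurable.
      rewrite /past setCI => w [|].
        by move=> /negP; rewrite -ltNge; left.
      move=> /existsNP[j /not_implyP[/= jk /negP]]; rewrite -ltNge => h; right.
      by rewrite -(bigcup_mkord k (fun j => [set w | (t j < g (X j w))%R])); exists j.
    rewrite (_ : 2 * r = r + r)%R; last by ring.
    rewrite EFinD.
    have mU : measurable (\big[setU/set0]_(j < k) [set w | (t j < g (X j w))%R]).
      by apply: bigsetU_measurable => j _; exact: mtail.
    apply: (le_trans (measureU2 P mSk mU)).
    apply: leeD; first exact: hS.
    apply: (@le_trans _ _ (\sum_(j < k) P [set w | (t j < g (X j w))%R])).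
      exact: (@Boole_inequality _ _ _ P (fun j => [set w | (t j < g (X j w))%R]) k (fun j _ => mtail j)).
    under eq_bigr do rewrite tail_law.
    have := sum_tail_le (y + C) k (ltW b0).
    move=> /le_trans/(_ (_ : _ <= (b * r)%:E)); rewrite lee_fin => /(_ hr).
    by rewrite EFinM lee_pmul2l// lte_fin.
  have : P (~` past k) \is a fin_num by rewrite fin_num_measure//; exact: measurableC.
  by move=> /fineK <-; rewrite -EFinB !lee_fin; lra.
have tA : trivIset setT A.
  apply/trivIsetP => i j _ _; wlog ij : i j / (i < j)%N.
    move=> h; rewrite neq_ltn => /orP[ij|ji]; first by apply: h => //; rewrite ltn_eqF.
    by rewrite setIC; apply: h => //; rewrite ltn_eqF.
  move=> _; apply/seteqP; split => // w [[[_ /= h1] _] [[[_ h2] _] _]].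
  by have := h2 i ij; rewrite /= leNgt h1.
have AL : \bigcup_k A k `<=` big_jump G y.
  move=> w [k _ [[[/= hk _] tk] Gk]]; exists k; split => //.
    by move: tk hk; rewrite /= /t; lra.
  have := ler0n R k; move: tk; rewrite /= /t; nra.
apply: (@le_trans _ _ (P (\bigcup_k A k))); last first.
  apply: le_measure; rewrite ?inE//; first exact: bigcup_measurable.
  exact: measurable_big_jump.
rewrite measure_bigcup//= (@eq_eseriesl _ _ xpredT) => [|k]; last by rewrite in_setT.
apply: (@le_trans _ _ (\sum_(0 <= k < n) P (A k))); last first.
  exact: nneseries_lim_ge.
rewrite big_mkord ge0_sume_distrr//.
apply: lee_sum => k _; rewrite PA EFinM -muleA.
apply: lee_pmul => //; [by rewrite lee_fin; lra|..].
  by rewrite mule_ge0// lee_fin; lra.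
by rewrite muleC; apply: lee_wpmul2l.
Qed.

End lower_bound.

Section big_jump_lower.
Local Open Scope ereal_scope.
Context d0 d d' (T0 : measurableType d0) (T : measurableType d)
  (U : measurableType d') (R : realType)
  (P0 : probability T0 R) (P : probability T R)
  (X0 : T0 -> U) (X : nat -> T -> U) (f g : U -> R) (F : probability R R).
Hypotheses (mX0 : measurable_fun setT X0)
  (mX : forall k, measurable_fun setT (X k))
  (copies : independent_copies P0 X0 P X)
  (mf : measurable_fun setT f) (mg : measurable_fun setT g)
  (ifX : P0.-integrable setT (EFin \o (f \o X0)))
  (igX : P0.-integrable setT (EFin \o (g \o X0))).
Local Notation Fb := (ftail F).

Lemma exceed_self_copies_small (h : U -> R) (b : R) :
  measurable_fun setT h -> (0 < b)%R ->
  P0.-integrable setT (EFin \o (h \o X0)) ->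
  \int[P0]_t (h (X0 t))%:E = (- b)%:E ->
  forall e, (0 < e)%R -> exists2 K, (0 <= K)%R &
    forall n, exceed P0 (h \o X0) (h \o X0) n K <= e%:E.
Proof.
move=> mh b0 ih hb.
have [p p01 hp] := exceed_self_lt1 mX0 mh mX copies ih b0 hb.
have mhX : measurable_fun setT (h \o X0) by exact: measurableT_comp.
exact: (exceed_self_small mhX ih b0 hb p01 hp).
Qed.

(** [r] comes before [G], since in the applications [G] is built from [r] by a quantile. *)
Lemma big_jump_lower (a e : R) : (0 < a)%R -> (0 < e)%R ->
  \int[P0]_t (f (X0 t))%:E = (- a)%:E ->
  (forall x, (0 < Fb x)%R) ->
  (forall y, asymp_equiv (fun x => excess P0 (g \o X0) (x + y)%R) Fb) ->
  exists2 r, (0 < r < 1)%R & forall G, measurable G ->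
  (1 - r)%:E <= P0 (X0 @^-1` G) ->
  exists y0, forall y, (y0 <= y)%R ->
    ((a^-1 - e) * Fb y)%:E <= P (big_jump X f g G y).
Proof.
move=> a0 e0 fa Fpos ZF.
have a'0 : (0 < a^-1)%R by rewrite invr_gt0.
(* The product [(1 - r) * (1 - 2 * r) * (1 - 2 * r)] is at least [1 - 5 * r], and
   [r * (5 + a^-1) <= e * a] gives [(a^-1 - e) * (a + r) <= 1 - 5 * r]. *)
pose r := Num.min (1 / 8)%R (e * a / (5 + a^-1))%R.
have r0 : (0 < r)%R by rewrite lt_min !divr_gt0 ?mulr_gt0//; lra.
have r8 : (r <= 1 / 8)%R by rewrite /r ge_min lexx.
have rea : (r * (5 + a^-1) <= e * a)%R.
  by rewrite -ler_pdivlMr; [rewrite /r ge_min lexx orbT|lra].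
exists r => [|G mG hG]; first by apply/andP; split; lra.
pose b := (a + r)%R; have b0 : (0 < b)%R by rewrite /b; lra.
have slope : (a^-1 - e <= (1 - r) * (1 - 2 * r) * (1 - 2 * r) / b)%R.
  rewrite ler_pdivlMr// /b; have aa : (a^-1 * a = 1)%R by rewrite mulVf// lt0r_neq0.
  have h1 : ((a^-1 - e) * (a + r) <= 1 - 5 * r)%R by nra.
  apply: (le_trans h1); nra.
(* These steps have mean [- r], so their walk stays below some [C] with probability at least
   [1 - r]; that is the lower line [- b * k - C] for [S k]. *)
pose f' p := (- (f p + b))%R.
have mf' : measurable_fun setT f' by rewrite /f'; meas.
have if' : P0.-integrable setT (EFin \o (f' \o X0)).
  rewrite (_ : EFin \o _ = -%E \o ((EFin \o (f \o X0)) \+ (EFin \o cst b)))//.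
  apply: integrableN => //; apply: integrableD => //.
  exact: finite_measure_integrable_cst.
have f'r : \int[P0]_t (f' (X0 t))%:E = (- r)%:E.
  rewrite (eq_integral (fun t => (- 1 * f (X0 t) - b)%:E)).
    by rewrite (integral_affine _ _ ifX fa); congr EFin; rewrite /b; ring.
  by move=> t _; rewrite /f'; congr EFin; ring.
have [C C0 hC] := exceed_self_copies_small mf' r0 if' f'r r0.
have mgX : measurable_fun setT (g \o X0) by exact: measurableT_comp.
have br : (0 < b * r)%R by rewrite mulr_gt0.
have [y1 hy1] := excess_cvg0 mgX igX br.
have [y2 hy2] := (asymp_equivP _ Fpos).1 (ZF C) _ r0.
exists (Num.max (Num.max y1 0) y2 + b)%R => y hy.
have h3 : (Num.max (Num.max y1 0) y2 <= y - b)%R by lra.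
move: h3; rewrite !ge_max => /andP[/andP[h1 h2] h4].
have y0 : (0 <= y)%R by lra.
have y2y : (y2 <= y)%R by lra.
have /andP[hFy _] := hy2 y y2y.
have hexc : (excess P0 (g \o X0) (y + C - b) <= b * r)%R.
  by apply/ltW/hy1; lra.
have hS k : P [set w | (walk (fun j w => f (X j w)) k w < - (b * k%:R) - C)%R] <= r%:E.
  apply: le_trans (hC k); rewrite -(crossing_exceed mX0 mf' mf' k C mX copies).
  apply: le_measure; rewrite ?inE.
  - have mS : measurable_fun setT (walk (fun j w => f (X j w)) k).
      by apply: measurable_walk => j _; meas.
    have h : measurable_fun setT
      (fun w => walk (fun j w => f (X j w)) k w < - (b * k%:R) - C)%R by meas.
    exact: measurable_bool_set h.
  - exact: measurable_crossing.
  move=> w /=; case: k => [|k] hk.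
    by move: hk; rewrite /walk big_ord0 mulr0; lra.
  exists k => //.
  have -> : (walk (fun j w => f' (X j w)) k w + f' (X k w) =
     - (walk (fun j w => f (X j w)) k.+1 w) - b * k.+1%:R)%R.
    rewrite /walk big_ord_recr/=.
    rewrite (eq_bigr (fun j : 'I_k => - (f (X j w)) - b)%R); last first.
      by move=> j _; rewrite /f' opprD.
    rewrite big_split/= sumrN sumr_const card_ord /f' -natr1 mulrDr mulr1.
    by rewrite -mulr_natr; ring.
  by lra.
have Fy := Fpos y.
have eta0 : (0 < r * Fb y)%R by rewrite mulr_gt0.
have [x3 hx3] := excess_cvg0 mgX igX eta0.
(* After [n] terms the remaining excess is below [r * Fb y]; a second [r * Fb y] is lost between
   [Fb y] and the excess over [y + C]. *)
pose n := (Num.trunc (`|x3 - (y + C)| / b)%R).+1.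
have hn : (x3 <= y + C + b * n%:R)%R.
  have : (`|x3 - (y + C)| / b < n%:R)%R by rewrite /n truncnS_gt.
  rewrite ltr_pdivrMr// => h; have := ler_norm (x3 - (y + C))%R; lra.
have h5 := hx3 _ hn.
have r12 : (0 <= r <= 1 / 2)%R by apply/andP; split; lra.
have key := big_jump_sum_ge mX0 mX copies mf mg igX n mG r12 b0 C0 y0 hG hS hexc.
apply: le_trans key.
have := sum_tail_ge mX0 mg igX (y + C) n (ltW b0).
set s := \sum_(j < n) _; have s0 : 0 <= s by apply: sume_ge0.
have sf : s \is a fin_num.
  apply/sum_fin_numP => j _ _; rewrite fin_num_measure//.
  have h : measurable_fun setT (fun t => y + C + b * j%:R < (g \o X0) t)%R by meas.
  exact: measurable_bool_set h.
rewrite -(fineK sf) -!EFinM -EFinD !lee_fin => h6.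
have h7 : ((1 - 2 * r) * Fb y <= b * fine s)%R by lra.
have h8 : ((1 - r) * (1 - 2 * r) * ((1 - 2 * r) * Fb y) / b <=
   (1 - r) * (1 - 2 * r) * fine s)%R.
  rewrite ler_pdivrMr// -!mulrA ler_wpM2l//; first by lra.
  by rewrite ler_wpM2l//; [lra|rewrite [leRHS]mulrC].
apply: le_trans h8; rewrite [leRHS](_ : _ =
  (1 - r) * (1 - 2 * r) * (1 - 2 * r) / b * Fb y)%R; last by ring.
by rewrite ler_pM2r.
Qed.

End big_jump_lower.

(** * Perpetuities *)

Section perpetuity_bounds.
Local Open Scope ereal_scope.
Context d0 d d' (T0 : measurableType d0) (T : measurableType d)
  (U : measurableType d') (R : realType)
  (P0 : probability T0 R) (P : probability T R)
  (X0 : T0 -> U) (X : nat -> T -> U) (f g : U -> R) (F : probability R R)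
  (D : T -> \bar R) (N : set T).
Hypotheses (mX0 : measurable_fun setT X0)
  (mX : forall k, measurable_fun setT (X k))
  (copies : independent_copies P0 X0 P X)
  (mf : measurable_fun setT f) (mg : measurable_fun setT g)
  (fg : forall p, (f p <= g p)%R)
  (ifX : P0.-integrable setT (EFin \o (f \o X0)))
  (igX : P0.-integrable setT (EFin \o (g \o X0)))
  (mD : forall x, measurable [set w | x < D w])
  (mN : measurable N) (PN : P N = 0).
Local Notation S := (walk (fun j w => f (X j w))).
Local Notation Fb := (ftail F).

Let null_union A : measurable A -> P (A `|` N) <= P A.
Proof.
move=> mA; apply: (le_trans (measureU2 P mA mN)).
by rewrite [X in _ + X]PN adde0.
Qed.

Lemma upper_probE (x : R) : (upper_prob P D x)%:E = P [set w | x%:E < D w].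
Proof. by rewrite /upper_prob fineK// fin_num_measure. Qed.

(** The factor [c] only shifts the level by [ln c], which long-tailedness absorbs. *)
Lemma perpetuity_lower (a e : R) : (0 < a)%R -> (0 < e < a^-1)%R ->
  \int[P0]_t (f (X0 t))%:E = (- a)%:E ->
  (forall x, (0 < Fb x)%R) ->
  (forall y, asymp_equiv (fun x => Fb (x + y)%R) Fb) ->
  (forall y, asymp_equiv (fun x => excess P0 (g \o X0) (x + y)%R) Fb) ->
  (forall r, (0 < r)%R -> exists (G : set U) (c y1 : R),
    [/\ measurable G, (1 - r)%:E <= P0 (X0 @^-1` G), (0 < c)%R &
      forall w k, ~ N w -> (y1 < g (X k w))%R -> G (X k.+1 w) ->
        (c * expR (S k w + g (X k w)))%:E <= D w]) ->
  exists x0, forall x, (x0 <= x)%R ->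
    ((a^-1 - e) * Fb (ln x) <= upper_prob P D x)%R.
Proof.
move=> a0 /andP[e0 ea] fa Fpos Flong ZF lo.
have e2 : (0 < e / 2)%R by lra.
have [r /andP[r0 r1] hr] := big_jump_lower mX0 mX copies mf mg ifX igX a0 e2 fa Fpos ZF.
have [G [c [y1 [mG hG c0 hD]]]] := lo r r0.
have [y0 hy0] := hr G mG hG.
have ae2 : (0 < a^-1 - e / 2)%R by lra.
pose q := (1 - (a^-1 - e) / (a^-1 - e / 2))%R.
have q0 : (0 < q)%R by rewrite /q subr_gt0 ltr_pdivrMr//; lra.
have [y2 hy2] := (asymp_equivP _ Fpos).1 (Flong (- ln c)%R) _ q0.
pose m := Num.max (Num.max (y0 + ln c) (y1 + ln c))%R y2.
exists (expR m) => x mx.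
have x0 : (0 < x)%R by rewrite (lt_le_trans (expR_gt0 m)).
have : (m <= ln x)%R by rewrite -(expRK m) ler_ln ?posrE ?expR_gt0.
rewrite /m !ge_max => /andP[/andP[h0 h1] h2].
pose y := (ln x - ln c)%R.
have y0y : (y0 <= y)%R by rewrite /y; lra.
have /andP[hF _] := hy2 _ h2.
have key := hy0 _ y0y.
have : P (big_jump X f g G y) <= P ([set w | x%:E < D w] `|` N).
  apply: le_measure; rewrite ?inE; first exact: measurable_big_jump.
    exact: measurableU.
  move=> w /= [k [h3 h4 h5]]; have [Nw|nNw] := pselect (N w); first by right.
  left; have y1g : (y1 < g (X k w))%R by rewrite /y in h4; lra.
  apply: lt_le_trans (hD w k nNw y1g h5); rewrite lte_fin.
  have -> : x = (c * expR y)%R.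
    by rewrite /y expRD expRN !lnK ?posrE//; field; exact: lt0r_neq0.
  by rewrite ltr_pM2l// ltr_expR.
have mDx := mD x%:E.
move=> h; have {h} := le_trans key (le_trans h (null_union mDx)).
rewrite -upper_probE lee_fin; apply: le_trans.
have -> : (a^-1 - e = (a^-1 - e / 2) * (1 - q))%R.
  by rewrite /q subKr mulrC divfK// lt0r_neq0.
by rewrite -mulrA ler_pM2l.
Qed.

Lemma crossing_union_le (f' g' : U -> R) (z B : R) :
  measurable_fun setT f' -> measurable_fun setT g' ->
  (forall n, exceed P0 (f' \o X0) (g' \o X0) n z <= B%:E) ->
  P (\bigcup_n crossing f' g' X n z) <= B%:E.
Proof.
move=> mf' mg' hB.
have mc n : measurable (crossing f' g' X n z) by exact: measurable_crossing.
have h := @nondecreasing_cvg_mu _ _ _ P _ mc (bigcup_measurable (fun n _ => mc n)).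
have {}h := h (ltac:(move=> m n mn; rewrite subsetEset => w [k km hk]; exists k => //;
  exact: leq_trans mn)).
rewrite -(cvg_lim _ h)//; apply: lime_le; first by apply/cvg_ex; exists (P (\bigcup_n crossing f' g' X n z)).
by apply: nearW => n /=; rewrite (crossing_exceed mX0 mf' mg' n z mX copies).
Qed.

(** Adding [r] to [f] and [g] reduces the drift to [a - r]. Where the modified walk never crosses
    [z], the hypothesis on [D] applies, and the factor [1 - expR (- r)] is again a mere shift of the
    level. *)
Lemma perpetuity_upper (a e : R) : (0 < a)%R -> (0 < e)%R ->
  \int[P0]_t (f (X0 t))%:E = (- a)%:E ->
  F `]-oo, 0%R[%classic = 0 ->
  asymp_equiv (fun x => fine (tail (convolution F F) x))
    (fun x => 2 * fine (tail F x))%R ->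
  (forall x, (0 < Fb x)%R) ->
  (forall y, asymp_equiv (fun x => Fb (x + y)%R) Fb) ->
  (forall y, asymp_equiv (fun x => excess P0 (g \o X0) (x + y)%R) Fb) ->
  (forall r z w, (0 < r)%R -> ~ N w ->
    (forall k, (S k w + g (X k w) + r * k.+1%:R <= z)%R) ->
    D w <= (expR z / (1 - expR (- r)))%:E) ->
  exists x0, forall x, (x0 <= x)%R ->
    (upper_prob P D x <= (a^-1 + e) * Fb (ln x))%R.
Proof.
move=> a0 e0 fa F0 Fsub Fpos Flong ZF up.
have a'0 : (0 < a^-1)%R by rewrite invr_gt0.
have [r r0 [ra hr]] : exists2 r, (0 < r)%R & (r < a)%R /\ ((a - r)^-1 <= a^-1 + e / 4)%R.
  have e4 : (0 < e / 4)%R by lra.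
  have [r /andP[r0 r1] h] := slope_choice a0 e4.
  (* [slope_choice] wants a drift strictly above [a - r], so the drift actually added is [r / 2]. *)
  have ar : (a - r < a - r / 2)%R by lra.
  have [h1 h2] := h (a - r / 2)%R r ar erefl.
  exists (r / 2)%R; first lra; split; first lra.
  apply: le_trans h2; rewrite ler_pdivlMr; last lra.
  have : (0 < (a - r / 2)^-1)%R by rewrite invr_gt0.
  nra.
pose f' p := (f p + r)%R; pose g' p := (g p + r)%R.
have mf' : measurable_fun setT f' by rewrite /f'; meas.
have mg' : measurable_fun setT g' by rewrite /g'; meas.
have ish (h : U -> R) : P0.-integrable setT (EFin \o (h \o X0)) ->
    P0.-integrable setT (EFin \o ((fun p => h p + r)%R \o X0)).
  move=> ih; rewrite (_ : EFin \o _ = (EFin \o (h \o X0)) \+ (EFin \o cst r))//.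
  by apply: integrableD => //; exact: finite_measure_integrable_cst.
have if' := ish f ifX; have ig' := ish g igX.
have f'r : \int[P0]_t (f' (X0 t))%:E = (- (a - r))%:E.
  rewrite (eq_integral (fun t => (1 * f (X0 t) + r)%:E)).
    by rewrite (integral_affine _ _ ifX fa); congr EFin; ring.
  by move=> t _; rewrite /f'; congr EFin; ring.
have ar0 : (0 < a - r)%R by lra.
have small := exceed_self_copies_small mX0 mX copies mf' ar0 if' f'r.
have mfX : measurable_fun setT (f' \o X0) by exact: measurableT_comp.
have mgX : measurable_fun setT (g' \o X0) by exact: measurableT_comp.
have fg' t : ((f' \o X0) t <= (g' \o X0) t)%R by rewrite /= lerD2r.
have ZF' y : asymp_equiv (fun x => excess P0 (g' \o X0) (x + y)%R) Fb.
  rewrite (_ : (fun x => _) = (fun x => excess P0 (g \o X0) (x + (y - r)))%R)//.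
  apply/funext => x; rewrite /excess; congr fine; apply: eq_integral => t _.
  by congr (Num.max _ _)%:E; rewrite /= /g'; ring.
have e4 : (0 < e / 4)%R by lra.
have [x0 hx0] := exceed_upper mfX mgX if' ig' fg' F0 Fsub ar0 f'r small Fpos Flong ZF' e4.
pose c := (1 - expR (- r))%R.
have c0 : (0 < c)%R by rewrite /c subr_gt0 -expR0 ltr_expR oppr_lt0.
pose q := (e / 2 / (a^-1 + e / 2))%R.
have q0 : (0 < q)%R by rewrite divr_gt0//; lra.
have [y2 hy2] := (asymp_equivP _ Fpos).1 (Flong (ln c)%R) _ q0.
pose m := Num.max (x0 - ln c)%R y2.
exists (expR m) => x mx.
have xp : (0 < x)%R by rewrite (lt_le_trans (expR_gt0 m)).
have : (m <= ln x)%R by rewrite -(expRK m) ler_ln ?posrE ?expR_gt0.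
rewrite /m ge_max => /andP[h0 h2].
have /andP[_ hF] := hy2 _ h2.
pose z := (ln x + ln c)%R.
have x0z : (x0 <= z)%R by rewrite /z; lra.
have hB := crossing_union_le mf' mg' (fun n => hx0 z n x0z).
have : P [set w | x%:E < D w] <= P ((\bigcup_n crossing f' g' X n z) `|` N).
  apply: le_measure; rewrite ?inE => //.
    by apply: measurableU => //; apply: bigcup_measurable => n _; exact: measurable_crossing.
  move=> w /= xD; have [Nw|nNw] := pselect (N w); first by right.
  left; apply: contrapT => ncr.
  have : D w <= (expR z / (1 - expR (- r)))%:E.
    apply: up => // k; rewrite leNgt; apply/negP => hk; apply: ncr.
    exists k.+1 => //; exists k => //.
    suff -> : (walk (fun j w => f' (X j w)) k w + g' (X k w) =
      S k w + g (X k w) + r * k.+1%:R)%R by [].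
    rewrite /walk /f' /g' big_split/= sumr_const card_ord -mulr_natr -natr1; ring.
  rewrite leNgt => /negP; apply; apply: le_lt_trans xD.
  by rewrite lee_fin -/c /z expRD !lnK ?posrE// mulfK ?lt0r_neq0.
have mc : measurable (\bigcup_n crossing f' g' X n z).
  by apply: bigcup_measurable => n _; exact: measurable_crossing.
move=> h; have {h} := le_trans h (le_trans (null_union mc) hB).
rewrite -upper_probE lee_fin => h; apply: (le_trans h).
have Fx := Fpos (ln x).
apply: (@le_trans _ _ ((a^-1 + e / 2) * Fb z))%R.
  by rewrite ler_wpM2r ?ftail_ge0//; lra.
have qE : ((a^-1 + e / 2) * q = e / 2)%R.
  by rewrite /q mulrC divfK// lt0r_neq0//; lra.
have := ler_wpM2l (_ : 0 <= a^-1 + e / 2)%R hF.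
move=> /(_ (ltac:(lra)))/le_trans; apply.
rewrite mulrA mulrDr mulr1 qE; nra.
Qed.

End perpetuity_bounds.

(** * Measurability of a series that need not converge *)

Section measurable_limit.
Local Open Scope ereal_scope.
Context d (T : measurableType d) (R : realType).

Lemma limn_einf_esup_cvg (s : (\bar R)^nat) :
  limn_einf s = limn_esup s -> cvgn s.
Proof.
rewrite limn_einf_lim limn_esup_lim => h.
apply/cvg_ex; exists (limn (einfs s)).
apply: (@squeeze_cvge _ _ _ _ (einfs s) _ (esups s)).
- near=> n; apply/andP; split.
    by apply: ge_ereal_inf; exists (s n) => //; exists n => /=.
  by apply: ereal_sup_ubound; exists n => /=.
- exact: is_cvg_einfs.
- by rewrite h; exact: is_cvg_esups.
Unshelve. all: by end_near. Qed.

(** Where the sequence diverges, [limn] has the default value [point]; convergence is detected by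
    the equality of lower and upper limit. *)
Lemma measurable_limn (s : nat -> T -> \bar R) :
  (forall n, measurable_fun setT (s n)) ->
  measurable_fun setT (fun w => limn (fun n => s n w)).
Proof.
move=> ms.
have m1 := measurable_fun_limn_esup ms.
have m2 : measurable_fun setT (fun w => limn_einf (fun n => s n w)).
  rewrite /limn_einf; apply: measurableT_comp => //.
  by apply: measurable_fun_limn_esup => n; apply: measurableT_comp.
rewrite (_ : (fun w => _) = (fun w =>
    if limn_einf (fun n => s n w) == limn_esup (fun n => s n w)
    then limn_esup (fun n => s n w) else point)); last first.
  apply/funext => w; case: ifPn => [/eqP|] h.
    by rewrite (is_cvg_limn_esupE (limn_einf_esup_cvg h)).
  apply/dvgP => /cvg_ex[l hl]; move: h.
  by rewrite !(cvg_limn_einf_sup hl) eqxx.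
by apply: measurable_fun_ifT => //; exact: measurable_fun_eqe.
Qed.

Lemma measurable_eseries (h : nat -> T -> R) (x : \bar R) :
  (forall k, measurable_fun setT (h k)) ->
  measurable [set w | x < \sum_(0 <= k <oo) (h k w)%:E].
Proof.
move=> mh.
have m : measurable_fun setT (fun w => \sum_(0 <= k <oo) (h k w)%:E).
  apply: (@measurable_limn (fun n w => \sum_(0 <= k < n) (h k w)%:E)) => n.
  by apply: emeasurable_sum => k; have ? := mh k; meas.
rewrite -[X in measurable X]setTI; exact: emeasurable_fun_o_infty.
Qed.

End measurable_limit.

Lemma limf_einf_ge (R : realType) (f : R -> \bar R) (l : R) :
  (forall e, 0 < e -> exists x0, forall x, x0 <= x -> ((l - e)%:E <= f x)%E) ->
  (l%:E <= limf_einf f +oo%R)%E.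
Proof.
move=> h; apply/lee_subgt0Pr => e e0; rewrite /limf_einf leeNr.
have [x0 hx0] := h e e0.
apply: ge_ereal_inf; exists (ereal_sup [set (- f x)%E | x in [set x | x0 <= x]]).
  by exists [set x | x0 <= x] => //; apply: nbhs_pinfty_ge; rewrite num_real.
apply: ge_ereal_sup => _ [x /= x0x <-]; rewrite EFinN leeN2.
exact: hx0.
Qed.

(** * The integrated tail as a mean excess *)

Section integrated_tail_excess.
Local Open Scope ereal_scope.
Context d (T : measurableType d) (R : realType) (P : probability T R)
  (Z : {RV P >-> R}).
Hypothesis iZ : P.-integrable setT (EFin \o Z).
Local Notation H := (distribution P Z).
Local Notation HI := (integrated_tail H).

Lemma integral_tail_excess x :
  \int[lebesgue_measure]_(y in `[x, +oo[) tail H y = (excess P Z x)%:E.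
Proof.
have mZ : measurable_fun setT Z by exact: measurable_funPT.
have mid : measurable_fun setT (fun y : R => y) by exact: measurable_id.
rewrite excessE// integral_mkcond.
transitivity (\int[@lebesgue_measure R]_y \int[P]_w
    (if ((x <= y) && (y < Z w))%R then 1 else 0)).
  apply: eq_integral => y _; rewrite patchE mem_setE in_itv/= andbT.
  case: ifP => xy; last by rewrite integral0_eq.
  rewrite integral_probability; last by meas.
  by congr (P _); apply/seteqP; split => w /=; rewrite in_itv/= andbT.
rewrite (@exchange_ge0_integral _ _ _ P _ _ (@lebesgue_measure R)); last 2 first.
- by meas.
- by move=> y w; case: ifP.
apply: eq_integral => w _.
transitivity (\int[@lebesgue_measure R]_y (\1_(`[x, Z w[%classic : set R) y)%:E).
  by apply: eq_integral => y _; rewrite indicE mem_setE in_itv/=; case: ifP.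
rewrite integral_indic// setIT [LHS]lebesgue_measure_itv/= lte_fin.
case: ifPn => xZ.
  by rewrite -EFinB; congr EFin; apply/esym/max_idPl; lra.
by congr EFin; apply/esym/max_idPr; lra.
Qed.

Lemma integrated_tail_distribution : is_integrated_tail H HI.
Proof.
apply: integrated_tailP; apply/integrableP; split.
  exact/measurable_EFinP/measurable_id.
rewrite ge0_integral_distribution//; last first.
  by apply: measurableT_comp => //; apply/measurable_EFinP; exact: measurable_id.
by move/integrableP : iZ => [].
Qed.

(** Once the excess is below [1], the minimum in the integrated tail is inactive. *)
Lemma integrated_tail_eventually : exists x0, forall x, (x0 <= x)%R ->
  ftail HI x = excess P Z x.
Proof.
have mZ : measurable_fun setT Z by exact: measurable_funPT.
have [x0 hx0] := excess_cvg0 mZ iZ ltr01.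
exists (Num.max x0 0)%R => x; rewrite ge_max => /andP[x0x x_ge0].
have [_ h] := integrated_tail_distribution.
apply/eqP; rewrite -eqe ftailE (h x x_ge0) integral_tail_excess.
by rewrite -EFin_min; apply/eqP; congr EFin; apply/min_idPr/ltW/hx0.
Qed.

Lemma excess_integrated_tail :
  (forall x, (0 < ftail HI x)%R) ->
  (forall y, asymp_equiv (fun x => ftail HI (x + y)%R) (ftail HI)) ->
  forall y, asymp_equiv (fun x => excess P Z (x + y)%R) (ftail HI).
Proof.
move=> Fpos Flong y; apply/asymp_equivP => // e e0.
have [x0 hx0] := (asymp_equivP _ Fpos).1 (Flong y) e e0.
have [x1 hx1] := integrated_tail_eventually.
exists (Num.max x0 (x1 - y))%R => x; rewrite ge_max => /andP[h0 h1].
rewrite -hx1; last lra.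
exact: hx0.
Qed.

End integrated_tail_excess.

Section perpetuity_asymptotics.
Local Open Scope ereal_scope.
Context d0 d d' (T0 : measurableType d0) (T : measurableType d)
  (U : measurableType d') (R : realType)
  (P0 : probability T0 R) (P : probability T R)
  (X0 : T0 -> U) (X : nat -> T -> U) (f g : U -> R) (Z : {RV P0 >-> R})
  (D : T -> \bar R) (N : set T).
Hypotheses (mX0 : measurable_fun setT X0)
  (mX : forall k, measurable_fun setT (X k))
  (copies : independent_copies P0 X0 P X)
  (mf : measurable_fun setT f) (mg : measurable_fun setT g)
  (fg : forall p, (f p <= g p)%R)
  (ifX : P0.-integrable setT (EFin \o (f \o X0)))
  (igX : P0.-integrable setT (EFin \o (g \o X0)))
  (iZ : P0.-integrable setT (EFin \o Z))
  (gZ : {ae P0, forall t, g (X0 t) = Z t})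
  (mD : forall x, measurable [set w | x < D w])
  (mN : measurable N) (PN : P N = 0).
Local Notation S := (walk (fun j w => f (X j w))).
Local Notation HI := (integrated_tail (distribution P0 Z)).

Let excess_ae x : excess P0 (g \o X0) x = excess P0 Z x.
Proof.
have mZ : measurable_fun setT Z by exact: measurable_funPT.
rewrite /excess; congr fine; apply: ae_eq_integral => //.
- by rewrite /comp; meas.
- by meas.
by apply: filterS gZ => t ht _ /=; rewrite ht.
Qed.

(** Both perpetuities fit here: apart from measurability, [D] enters by two pathwise inequalities
    off a null set. [g] and [Z] are kept apart because [f <= g] is required everywhere, while [Z] is
    the variable of the theorem and equals [g] only almost surely. *)
Lemma perpetuity_asymptotics (a : R) : (0 < a)%R ->
  \int[P0]_t (f (X0 t))%:E = (- a)%:E ->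
  (forall r, (0 < r)%R -> exists (G : set U) (c y1 : R),
    [/\ measurable G, (1 - r)%:E <= P0 (X0 @^-1` G), (0 < c)%R &
      forall w k, ~ N w -> (y1 < g (X k w))%R -> G (X k.+1 w) ->
        (c * expR (S k w + g (X k w)))%:E <= D w]) ->
  (forall r z w, (0 < r)%R -> ~ N w ->
    (forall k, (S k w + g (X k w) + r * k.+1%:R <= z)%R) ->
    D w <= (expR z / (1 - expR (- r)))%:E) ->
  long_tailed HI ->
    (a^-1)%:E <= limf_einf (fun x : R =>
        (upper_prob P D x / fine (tail HI (ln x)))%:E) +oo%R /\
    (subexponential HI ->
      asymp_equiv (upper_prob P D) (fun x => a^-1 * fine (tail HI (ln x)))%R).
Proof.
move=> a0 fa lo up [Fpos' Flong].
have Fpos x : (0 < ftail HI x)%R by rewrite -lte_fin ftailE.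
have a'0 : (0 < a^-1)%R by rewrite invr_gt0.
have ZF y : asymp_equiv (fun x => excess P0 (g \o X0) (x + y)%R) (ftail HI).
  rewrite (_ : (fun x => _) = (fun x => excess P0 Z (x + y)%R)).
    exact: excess_integrated_tail.
  by apply/funext => x; exact: excess_ae.
have lower e : (0 < e)%R -> exists x0, forall x, (x0 <= x)%R ->
    ((a^-1 - e) * ftail HI (ln x) <= upper_prob P D x)%R.
  move=> e0; pose e' := Num.min e (a^-1 / 2)%R.
  have e'0 : (0 < e' < a^-1)%R.
    by rewrite lt_min e0 divr_gt0//= gt_min; apply/orP; right; lra.
  have e'e : (e' <= e)%R by rewrite ge_min lexx.
  have [x0 hx0] := perpetuity_lower mX0 mX copies mf mg ifX igX mD mN PN a0 e'0 fa
    Fpos Flong ZF lo.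
  exists x0 => x /hx0; apply: le_trans; rewrite ler_pM2r//; lra.
split.
  apply: limf_einf_ge => e e0; have [x0 hx0] := lower e e0.
  by exists x0 => x /hx0 h; rewrite lee_fin ler_pdivlMr//; exact: Fpos.
move=> [F0 _ Fsub]; apply/asymp_equivP => [x|e e0].
  by rewrite mulr_gt0//; exact: Fpos.
have ea : (0 < e * a^-1)%R by rewrite mulr_gt0.
have [x0 hx0] := lower _ ea.
have [x1 hx1] := perpetuity_upper mX0 mX copies mf mg fg ifX igX mD mN PN a0 ea fa
  F0 Fsub Fpos Flong ZF up.
exists (Num.max x0 x1)%R => x; rewrite ge_max => /andP[h0 h1].
have := hx0 x h0; have := hx1 x h1; rewrite -/(ftail HI (ln x)) => h3 h4.
by apply/andP; split; lra.
Qed.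

End perpetuity_asymptotics.

(** * Pathwise bounds and the two perpetuities *)

Section series_bounds.
Context (R : realType) (h : nat -> R).
Hypothesis h0 : forall k, 0 <= h k.

Lemma le_geometric_eseries (z r : R) : 0 < r ->
  (forall k, h k <= expR (z - r * k.+1%:R)) ->
  (\sum_(0 <= k <oo) (h k)%:E <= (expR z / (1 - expR (- r)))%:E)%E.
Proof.
move=> r0 hz; pose q := expR (- r).
have q0 : 0 < q by exact: expR_gt0.
have q1 : q < 1 by rewrite -expR0 ltr_expR oppr_lt0.
apply: lime_le; first by apply: is_cvg_nneseries => k _ _; rewrite lee_fin.
apply: nearW => n; rewrite sumEFin lee_fin ler_pdivlMr ?subr_gt0// -/q.
have : (\sum_(0 <= k < n) h k) * (1 - q) <= expR z * (1 - q ^+ n).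
  elim: n => [|n ih]; first by rewrite big_geq// mul0r expr0 subrr mulr0.
  rewrite big_nat_recr//= mulrDl; apply: (le_trans (lerD ih (lexx _))).
  (* One factor [q] is given away. *)
  have hq : h n <= expR z * q ^+ n.
    apply: (le_trans (hz n)); rewrite /q -expRM_natl -expRD ler_expR.
    rewrite -mulr_natl -[n.+1%:R]natr1; nra.
  rewrite exprS; have := ler_wpM2r (_ : 0 <= 1 - q) hq.
  by move=> /(_ (ltac:(lra))); lra.
move=> /le_trans; apply; rewrite ger_pMr ?expR_gt0//.
by rewrite gerBl exprn_ge0// ltW.
Qed.

Lemma two_terms_le_eseries k : ((h k + h k.+1)%:E <= \sum_(0 <= k <oo) (h k)%:E)%E.
Proof.
apply: (@le_trans _ _ (\sum_(0 <= j < k.+2) (h j)%:E)%E); last first.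
  by apply: nneseries_lim_ge => j _ _; rewrite lee_fin.
rewrite !big_nat_recr//= -addeA EFinD leeDr// sume_ge0// => j _.
by rewrite lee_fin.
Qed.

End series_bounds.

(** Continuity from below along [n.+2%:R^-1]. Starting at [1 / 2] ensures [c <= 1 / 2], whence
    [c * (1 + eta) <= eta] for [eta > 1]. *)
Lemma positive_lower_quantile d (T : measurableType d) (R : realType)
    (P : probability T R) (Y : T -> R) (r : R) :
  measurable_fun setT Y -> {ae P, forall w, 0 < Y w} -> 0 < r ->
  exists2 c, 0 < c <= 1 / 2 & ((1 - r)%:E <= P [set w | (c <= Y w)%R])%E.
Proof.
move=> mY Y0 r0.
pose A n := [set w | (n.+2%:R^-1 <= Y w)%R].
have mA n : measurable (A n).
  have h : measurable_fun setT (fun w => n.+2%:R^-1 <= Y w)%R by meas.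
  exact: measurable_bool_set h.
have mUA : measurable (\bigcup_n A n) by exact: bigcup_measurable.
have ndA : {homo A : n m / (n <= m)%N >-> (n <= m)%O}.
  move=> m n mn; rewrite subsetEset => w /=; apply: le_trans.
  by rewrite lef_pV2 ?posrE// ler_nat.
have PUA : P (\bigcup_n A n) = 1%E.
  apply/eqP; rewrite eq_le probability_le1//=.
  have : P (~` \bigcup_n A n) = 0%E.
    apply/negligibleP; first exact: measurableC.
    apply: negligibleS Y0 => w /= nA Yw; apply: nA.
    have [n _ hn] := near_infty_natSinv_lt (PosNum Yw).
    exists n => //=; rewrite /A/=; apply: le_trans (ltW (hn n (leqnn n))).
    by rewrite lef_pV2 ?posrE// ler_nat.
  rewrite probability_setC// => /eqP; rewrite sube_eq ?fin_num_adde_defl ?fin_num_measure//.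
  by rewrite add0e => /eqP <-.
have hcvg : P (A n) @[n --> \oo] --> 1%E.
  by rewrite -PUA; exact: nondecreasing_cvg_mu.
have fA n : P (A n) \is a fin_num by rewrite fin_num_measure.
move: hcvg => /fine_cvg /cvgrPdist_lt /(_ r r0) [n _ /(_ n (leqnn n)) /= hn].
exists n.+2%:R^-1.
  rewrite invr_gt0 ltr0n/= div1r lef_pV2 ?posrE// ler_nat//.
have h1 := ler_norm (1 - fine (P (A n))).
by rewrite -(fineK (fA n)) lee_fin; lra.
Qed.

Lemma null_nonpositive d0 d (T0 : measurableType d0) (T : measurableType d)
    (R : realType) (P0 : probability T0 R) (P : probability T R)
    (Y0 : T0 -> R) (Y : nat -> T -> R) :
  measurable_fun setT Y0 -> (forall k, measurable_fun setT (Y k)) ->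
  (forall k, same_law P0 Y0 P (Y k)) -> {ae P0, forall t, 0 < Y0 t} ->
  measurable [set w | exists k, Y k w <= 0] /\
  P [set w | exists k, Y k w <= 0] = 0%E.
Proof.
move=> mY0 mY law Y0pos.
have mneg : measurable [set y : R | y <= 0].
  by rewrite (_ : mkset _ = `]-oo, 0]%classic)//; apply/seteqP; split => y /=; rewrite in_itv.
have NE : [set w | exists k, Y k w <= 0] =
    \bigcup_k (Y k @^-1` [set y | y <= 0]).
  by apply/seteqP; split => w /= => [[k hk]|[k _ hk]]; exists k.
have mk k : measurable (Y k @^-1` [set y | y <= 0]).
  by rewrite -[X in measurable X]setTI; exact: mY.
rewrite NE; split; first exact: bigcup_measurable.
apply/negligibleP; first exact: bigcup_measurable.
apply: negligible_bigcup => k; apply/negligibleP => //.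
apply: (etrans (law k _ mneg)); apply/negligibleP.
  by rewrite -[X in measurable X]setTI; exact: mY0.
by apply: negligibleS Y0pos => t /= h; rewrite ltNge h.
Qed.

Theorem theorem1 (R : realType)
    (d0 : measure_display) (T0 : measurableType d0) (P0 : probability T0 R)
    (d : measure_display) (T : measurableType d) (P : probability T R)
    (xi eta : {RV P0 >-> R})
    (xi_ eta_ : nat -> {RV P >-> R})
    (a : R)
    (copies : independent_copies P0 (fun w => (xi w, eta w))
                P (fun k w => (xi_ k w, eta_ k w)))
    (xi_pos : (0 < P0 [set w | (0 < xi w)%R])%E)
    (a_gt0 : 0 < a)
    (xi_int : P0.-integrable setT (EFin \o xi))
    (xi_mean : ('E_P0[xi] = (- a)%:E)%E)
    (eta_pos : {ae P0, forall w, 0 < eta w})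
    (eta_log : ('E_P0[log1p eta] < +oo)%E) :
  let D := perpetuity xi_ eta_ in
  let D' := perpetuity_tilde xi_ eta_ in
  let H : probability R R := distribution P0 (xi \+ log1p eta) in
  let H' : probability R R := distribution P0 (xi \max log1p eta) in
  let HI := integrated_tail H in
  let HI' := integrated_tail H' in
  (long_tailed HI ->
    ((a^-1)%:E <=
      limf_einf (fun x : R =>
        (upper_prob P D x / fine (tail HI (ln x)))%:E) +oo%R)%E /\
    (subexponential HI ->
      asymp_equiv (upper_prob P D) (fun x => a^-1 * fine (tail HI (ln x)))))
  /\
  (long_tailed HI' ->
    ((a^-1)%:E <=
      limf_einf (fun x : R =>
        (upper_prob P D' x / fine (tail HI' (ln x)))%:E) +oo%R)%E /\
    (subexponential HI' ->
      asymp_equiv (upper_prob P D') (fun x => a^-1 * fine (tail HI' (ln x))))).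
Proof.
move=> D D' H H' HI HI'.
pose X0 w := (xi w, eta w); pose X k w := (xi_ k w, eta_ k w).
pose L := log1p eta.
have mxi : measurable_fun setT xi by exact: measurable_funPT.
have meta : measurable_fun setT eta by exact: measurable_funPT.
have mxi_ k : measurable_fun setT (xi_ k) by exact: measurable_funPT.
have meta_ k : measurable_fun setT (eta_ k) by exact: measurable_funPT.
have mL : measurable_fun setT L by exact: measurable_funPT.
have mX0 : measurable_fun setT X0 by rewrite /X0; meas.
have mX k : measurable_fun setT (X k).
  by have ? := mxi_ k; have ? := meta_ k; rewrite /X; meas.
have mln : measurable_fun setT (@ln R) by exact: measurable_ln.
pose f (p : R * R) := p.1.
(* The maximum secures [f <= g] also off the event [eta > 0]; almost surely it is the second
   entry. *)
pose g (p : R * R) := Num.max p.1 (p.1 + ln (1 + p.2)).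
pose g' (p : R * R) := Num.max p.1 (ln (1 + p.2)).
have mf : measurable_fun setT f by exact: measurable_fst.
have mg : measurable_fun setT g by rewrite /g; meas.
have mg' : measurable_fun setT g' by rewrite /g'; meas.
have L0 : {ae P0, forall w, 0 <= L w}.
  apply: filterS eta_pos => w h; rewrite /L /log1p ln_ge0// lerDl; exact: ltW.
have iL : P0.-integrable setT (EFin \o L).
  apply/integrableP; split; first exact/measurable_EFinP.
  move: eta_log; rewrite expectation_def; congr (_ < _)%E.
  apply: ae_eq_integral => //.
  - exact/measurable_EFinP.
  - by apply: measurableT_comp => //; exact/measurable_EFinP.
  - by apply: filterS L0 => w h _ /=; rewrite ger0_norm.
have ixi : P0.-integrable setT (EFin \o (f \o X0)) by exact: xi_int.
have isum : P0.-integrable setT (fun w => (`|xi w| + `|L w|)%:E).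
  rewrite (_ : (fun w => _) = (abse \o (EFin \o xi)) \+ (abse \o (EFin \o L)))//.
  by apply: integrableD => //; exact: integrable_abse.
have igX : P0.-integrable setT (EFin \o (g \o X0)).
  apply: (le_integrable _ _ _ isum) => //.
    by apply/measurable_EFinP; exact: measurableT_comp.
  move=> w _; rewrite /= lee_fin [leRHS]ger0_norm ?addr_ge0//.
  rewrite /g/=; case: (leP (xi w)) => _; last by rewrite lerDl.
  exact: ler_normD.
have ig'X : P0.-integrable setT (EFin \o (g' \o X0)).
  apply: (le_integrable _ _ _ isum) => //.
    by apply/measurable_EFinP; exact: measurableT_comp.
  move=> w _; rewrite /= lee_fin [leRHS]ger0_norm ?addr_ge0//.
  by rewrite /g'/=; case: (leP (xi w)) => _; rewrite ?lerDl ?lerDr.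
have fmean : (\int[P0]_t (f (X0 t))%:E = (- a)%:E)%E.
  by rewrite -xi_mean expectation_def.
have law_eta k : same_law P0 eta P (eta_ k).
  move=> A mA; have mA' : measurable (snd @^-1` A : set (R * R)).
    by rewrite -[X in measurable X]setTI; exact: measurable_snd.
  exact: (copies.1 k _ mA').
have [mN PN] := null_nonpositive meta meta_ law_eta eta_pos.
set N := [set w | _] in mN PN.
have posN w k : ~ N w -> 0 < eta_ k w.
  by move=> nN; rewrite ltNge; apply/negP => h; apply: nN; exists k.
have wS n : measurable_fun setT (walk xi_ n) by apply: measurable_walk => k _; exact: mxi_.
have mexp : measurable_fun setT (@expR R) by exact: measurable_expR.
have Sr n w : walk xi_ n.+1 w = walk xi_ n w + xi_ n w by rewrite /walk big_ord_recr.
have lnK1 w k : ~ N w -> expR (ln (1 + eta_ k w)) = 1 + eta_ k w.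
  by move=> nN; rewrite lnK// posrE; have := posN w k nN; lra.
split.
- apply: (@perpetuity_asymptotics _ _ _ _ _ _ _ P0 P X0 X f g _ D N) => //.
  + by move=> p; rewrite le_max lexx.
  + rewrite (_ : EFin \o _ = (EFin \o xi) \+ (EFin \o L))//.
    exact: integrableD.
  + by apply: filterS L0 => w Lw; apply/max_idPr; rewrite lerDl.
  + move=> x; apply: measurable_eseries => k.
    by have ? := meta_ k; have ? := wS k.+1; meas.
  + move=> r r0.
    have mh : measurable_fun setT (fun w => eta w * expR (xi w)) by meas.
    have h0 : {ae P0, forall w, 0 < eta w * expR (xi w)}.
      by apply: filterS eta_pos => w ?; rewrite mulr_gt0// expR_gt0.
    have [c /andP[c0 c2] hc] := positive_lower_quantile mh h0 r0.
    (* In [c * (1 + eta_k)] the part [c * eta_k] is covered by the big term and [c] by the next one,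
       after division by [expR] of the walk at time [k.+1]. *)
    exists [set p | c <= p.2 * expR p.1], c, 0; split => //.
      have h : measurable_fun setT (fun p : R * R => c <= p.2 * expR p.1) by meas.
      exact: measurable_bool_set h.
    move=> w k nN _ /= hG.
    have hk j : 0 <= eta_ j w * expR (walk xi_ j.+1 w).
      by rewrite mulr_ge0 ?expR_ge0// ltW// posN.
    apply: le_trans (two_terms_le_eseries hk k); rewrite lee_fin.
    have eta0 := posN w k nN.
    have -> : g (X k w) = xi_ k w + ln (1 + eta_ k w).
      by apply/max_idPr; rewrite /= lerDl ln_ge0// lerDl ltW.
    rewrite !expRD lnK1// !Sr !expRD.
    have := expR_gt0 (walk xi_ k w); have := expR_gt0 (xi_ k w).
    set s := expR (walk _ _ _); set x := expR (xi_ k w) => x0 s0.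
    have sx0 : 0 < s * x by rewrite mulr_gt0.
    have h1 : c * (1 + eta_ k w) <= eta_ k w + eta_ k.+1 w * expR (xi_ k.+1 w).
      by nra.
    have := ler_wpM2l (ltW sx0) h1; rewrite -/s; lra.
  + move=> r z w r0 nN hz; apply: le_geometric_eseries => // k.
      by rewrite mulr_ge0 ?expR_ge0// ltW// posN.
    apply: (@le_trans _ _ (expR (walk xi_ k w + g (X k w)))); last first.
      by rewrite ler_expR; have := hz k; rewrite -/(walk xi_ k w); lra.
    have eta0 := posN w k nN.
    have -> : g (X k w) = xi_ k w + ln (1 + eta_ k w).
      by apply/max_idPr; rewrite /= lerDl ln_ge0// lerDl ltW.
    rewrite Sr !expRD lnK1//.
    by have := mulr_gt0 (expR_gt0 (walk xi_ k w)) (expR_gt0 (xi_ k w)); lra.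
- apply: (@perpetuity_asymptotics _ _ _ _ _ _ _ P0 P X0 X f g' _ D' N) => //.
  + by move=> p; rewrite le_max lexx.
  + by apply: aeW.
  + move=> x; apply: measurable_eseries => k.
    by have ? := meta_ k; have ? := wS k; meas.
  + move=> r r0.
    have [c /andP[c0 c2] hc] := positive_lower_quantile meta eta_pos r0.
    (* If [g'] is attained by [xi], the next term carries the factor [expR xi] and [G] suffices. If
       it is attained by [ln (1 + eta)], the level [ln 2] forces [eta > 1], and the big term alone
       suffices. *)
    exists [set p | c <= p.2], c, (ln 2); split => //.
      have h : measurable_fun setT (fun p : R * R => c <= p.2) by meas.
      exact: measurable_bool_set h.
    move=> w k nN hg /= hG.
    have hk j : 0 <= eta_ j w * expR (walk xi_ j w).
      by rewrite mulr_ge0 ?expR_ge0// ltW// posN.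
    apply: le_trans (two_terms_le_eseries hk k); rewrite lee_fin.
    have eta0 := posN w k nN.
    rewrite Sr !expRD.
    have := expR_gt0 (walk xi_ k w); have := expR_gt0 (xi_ k w).
    set s := expR (walk _ _ _); set x := expR (xi_ k w) => x0 s0.
    suff h1 : c * expR (g' (X k w)) <= eta_ k w + eta_ k.+1 w * x.
      have := ler_wpM2l (ltW s0) h1; rewrite -/s; lra.
    move: hg; rewrite /g' /X/=; case: (leP (xi_ k w)) => hx hg; last first.
      by rewrite -/x; have := ler_wpM2r (ltW x0) hG; lra.
    rewrite lnK1//; move: hg; rewrite ltr_ln ?posrE//; last lra.
    by move=> h2; nra.
  + move=> r z w r0 nN hz; apply: le_geometric_eseries => // k.
      by rewrite mulr_ge0 ?expR_ge0// ltW// posN.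
    apply: (@le_trans _ _ (expR (walk xi_ k w + g' (X k w)))); last first.
      by rewrite ler_expR; have := hz k; rewrite -/(walk xi_ k w); lra.
    have eta0 := posN w k nN.
    rewrite expRD mulrC ler_wpM2l ?expR_ge0//.
    apply: (@le_trans _ _ (expR (ln (1 + eta_ k w)))); first by rewrite lnK1//; lra.
    by rewrite ler_expR /g' le_max lexx orbT.
Qed.
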